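(* Let $p_1,p_2$ be positive integers and let $T_1,T_2$ be the rectangular tiles of dimensions $p_1\times 1$ and $p_2\times 1$, i.e.\ $T_c=\{0,\dots,p_c-1\}\times\{0\}$ for $c\in\{1,2\}$. Then the $\{T_1,T_2\}$-tiling tomography problem can be solved in polynomial time: there is a polynomial-time algorithm that, given $m,n$ and vectors $r^1,r^2\in\mathbb N^m$, $s^1,s^2\in\mathbb N^n$, either outputs a matrix $M\in\{0,1,2\}^{m\times n}$ that is a solution of the instance, or correctly reports that no solution exists.
   Context: A tile is a finite 4-connected set of cells of $\mathbb N\times\mathbb N$; for a tile $T$, $T+(i',j')=\{(i+i',j+j'):(i,j)\in T\}$ (shift $i'$ down, $j'$ right). Given tiles $T_1,\dots,T_k$, an $m\times n$ grid, and vectors $r^d\in\mathbb N^m$, $s^d\in\mathbb N^n$ ($1\le d\le k$), a solution of the tiling tomography instance is a matrix $M\in\{0,1,\dots,k\}^{m\times n}$ such that the tiles $T_d+(i,j)$ for all $(i,j)$ with $M_{ij}=d\ne0$ are pairwise disjoint and their union is exactly the set of cells of the $m\times n$ grid, and $r^d_i=|\{j:M_{ij}=d\}|$, $s^d_j=|\{i:M_{ij}=d\}|$ for all $i,j,d$. *)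

(* Defs.v *)
From HB Require Import structures.
From mathcomp Require Import all_boot all_order all_algebra.
From mathcomp Require Import finmap.

Set Implicit Arguments.
Unset Strict Implicit.
Unset Printing Implicit Defensive.

(** * Tiles and tiling tomography *)

(* A cell is (row, column), rows numbered downwards. *)
Definition cell : Type := (nat * nat)%type.

Definition adj4 : rel cell := fun c c' =>
  ((c.1 == c'.1) && ((c'.2 == c.2.+1) || (c.2 == c'.2.+1)))
  || ((c.2 == c'.2) && ((c'.1 == c.1.+1) || (c.1 == c'.1.+1))).

Definition connected4 (A : {fset cell}) : Prop :=
  forall c c', c \in A -> c' \in A ->
  exists p : seq cell, [/\ path adj4 c p, all (mem A) p & last c p = c'].

Record tile := Tile { tcells :> {fset cell}; _ : connected4 tcells }.

Definition shift (T : {fset cell}) (i' j' : nat) : {fset cell} :=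
  [fset ((c.1 + i', c.2 + j')%N : cell) | c in T]%fset.

Definition vbar_cells (p : nat) : {fset cell} :=
  [fset ((i, 0%N) : cell) | i in iota 0 p]%fset.

Lemma mem_vbar_cells p (c : cell) :
  (c \in vbar_cells p) = (c.1 < p) && (c.2 == 0%N).
Proof.
apply/imfsetP/andP => [[i /=]|[lt_p /eqP c2]].
  by rewrite mem_iota => /andP[_ lt_ip] ->.
by exists c.1; rewrite /= ?mem_iota // -c2; case: c {lt_p c2}.
Qed.

Lemma vbar_connected p : connected4 (vbar_cells p).
Proof.
have down i d : i + d < p -> exists s : seq cell,
    [/\ path adj4 (i, 0%N) s, all (mem (vbar_cells p)) s
      & last (i, 0%N) s = (i + d, 0%N)].
  elim: d => [|d IHd] lt_p; first by exists [::]; rewrite addn0.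
  have [|s [ps As ls]] := IHd; first by apply: leq_trans lt_p; rewrite addnS.
  exists (rcons s (i + d.+1, 0%N)); rewrite last_rcons rcons_path ps ls all_rcons.
  by rewrite /= mem_vbar_cells /= lt_p As /adj4 /= addnS eqxx orbT.
have up i d : i + d < p -> exists s : seq cell,
    [/\ path adj4 (i + d, 0%N) s, all (mem (vbar_cells p)) s
      & last (i + d, 0%N) s = (i, 0%N)].
  elim: d => [|d IHd] lt_p; first by exists [::]; rewrite addn0.
  have lt_p' : i + d < p by apply: leq_trans lt_p; rewrite addnS.
  have [s [ps As ls]] := IHd lt_p'.
  exists ((i + d, 0%N) :: s); rewrite /= ps ls As mem_vbar_cells /= lt_p'.
  by rewrite /adj4 /= addnS eqxx !orbT.
move=> [i z] [i' z']; rewrite !mem_vbar_cells /=.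
move=> /andP[lt_i /eqP->] /andP[lt_i' /eqP->].
have [le_ii'|/ltnW le_i'i] := leqP i i'.
  by have := down i (i' - i); rewrite subnKC //; apply.
by have := up i' (i - i'); rewrite subnKC //; apply.
Qed.

(* The p x 1 rectangle {0, ..., p-1} x {0}. *)
Definition vbar (p : nat) : tile := Tile (@vbar_connected p).

(* A tile index d in {1, ..., k} is [d : 'I_k] here, and it appears in the
   matrix as [lift ord0 d : 'I_k.+1], whose value is d + 1; [ord0] means that
   no tile is placed. *)
Record instance (k : nat) := Instance {
  nrows : nat;
  ncols : nat;
  rproj : 'I_k -> nrows.-tuple nat;
  sproj : 'I_k -> ncols.-tuple nat }.

Definition candidate (k : nat) (I : instance k) : Type :=
  'M['I_k.+1]_(nrows I, ncols I).

Definition is_solution (k : nat) (T : 'I_k -> tile) (I : instance k)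
    (M : candidate I) : Prop :=
  [/\ forall i j d i' j' d',
        M i j = lift ord0 d -> M i' j' = lift ord0 d' -> (i, j) <> (i', j') ->
        [disjoint shift (T d) i j & shift (T d') i' j']%fset,
      forall c : cell,
        (exists i j d, M i j = lift ord0 d /\ c \in shift (T d) i j)
        <-> (c.1 < nrows I) && (c.2 < ncols I),
      forall d i, tnth (rproj I d) i = #|[set j | M i j == lift ord0 d]|
    & forall d j, tnth (sproj I d) j = #|[set i | M i j == lift ord0 d]| ].

(** * Polynomial time: random access machine with logarithmic cost *)

(* Length of the binary numeral of n, with bits 0 = 1. *)
Definition bits (n : nat) : nat := (trunc_log 2 n).+1.

Inductive binop := OAdd | OSub | OMul.

Definition bin_val (o : binop) : nat -> nat -> nat :=
  match o with OAdd => addn | OSub => subn | OMul => muln end.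

Inductive expr :=
| Cst of nat
| Mem of expr
| Bin of binop & expr & expr.

Inductive cmd :=
| Skip
| Store of expr & expr
| Read of expr
| Write of expr
| Seq of cmd & cmd
| If of expr & cmd & cmd
| While of expr & cmd.

Record state := State {
  mem_of : nat -> nat;
  inp_of : seq nat;
  out_of : seq nat }.

Definition init_state (w : seq nat) : state := State (fun _ => 0%N) w [::].

Definition upd (mu : nat -> nat) (a v : nat) : nat -> nat :=
  fun b => if b == a then v else mu b.

Fixpoint eval (mu : nat -> nat) (e : expr) : nat :=
  match e with
  | Cst n => n
  | Mem e1 => mu (eval mu e1)
  | Bin o e1 e2 => bin_val o (eval mu e1) (eval mu e2)
  end.

(* Every operation is charged the bit length of all the numbers it handles,
   addresses included. *)
Fixpoint ecost (mu : nat -> nat) (e : expr) : nat :=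
  match e with
  | Cst n => bits n
  | Mem e1 => ecost mu e1 + bits (eval mu e1) + bits (mu (eval mu e1))
  | Bin _ e1 e2 =>
      ecost mu e1 + ecost mu e2 + bits (eval mu e1) + bits (eval mu e2)
  end.

(* [exec c st t st']: started in st, the program c halts in st' at cost t.
   Reading past the end of the input yields 0; a test succeeds iff its value
   is nonzero. *)
Inductive exec : cmd -> state -> nat -> state -> Prop :=
| ExSkip st : exec Skip st 1 st
| ExStore e1 e2 mu w o :
    exec (Store e1 e2) (State mu w o)
      (ecost mu e1 + ecost mu e2 + bits (eval mu e1) + bits (eval mu e2))
      (State (upd mu (eval mu e1) (eval mu e2)) w o)
| ExRead e mu w o :
    exec (Read e) (State mu w o)
      (ecost mu e + bits (eval mu e) + bits (head 0%N w))
      (State (upd mu (eval mu e) (head 0%N w)) (behead w) o)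
| ExWrite e mu w o :
    exec (Write e) (State mu w o)
      (ecost mu e + bits (eval mu e))
      (State mu w (rcons o (eval mu e)))
| ExSeq c1 c2 st st1 st2 t1 t2 :
    exec c1 st t1 st1 -> exec c2 st1 t2 st2 ->
    exec (Seq c1 c2) st (t1 + t2) st2
| ExIf e c1 c2 st st' t :
    exec (if eval (mem_of st) e != 0%N then c1 else c2) st t st' ->
    exec (If e c1 c2) st
      (ecost (mem_of st) e + bits (eval (mem_of st) e) + t) st'
| ExWhileEnd e c st :
    eval (mem_of st) e = 0%N ->
    exec (While e c) st (ecost (mem_of st) e + bits (eval (mem_of st) e)) st
| ExWhileStep e c st st1 st2 t1 t2 :
    eval (mem_of st) e <> 0%N ->
    exec c st t1 st1 -> exec (While e c) st1 t2 st2 ->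
    exec (While e c) st
      (ecost (mem_of st) e + bits (eval (mem_of st) e) + t1 + t2) st2.

Lemma exec_det c st t1 st1 t2 st2 :
  exec c st t1 st1 -> exec c st t2 st2 -> t1 = t2 /\ st1 = st2.
Proof.
move=> ex1; elim: ex1 t2 st2 => {c st t1 st1}.
- by move=> st t2 st2 ex2; inversion ex2; subst.
- by move=> e1 e2 mu w o t2 st2 ex2; inversion ex2; subst.
- by move=> e mu w o t2 st2 ex2; inversion ex2; subst.
- by move=> e mu w o t2 st2 ex2; inversion ex2; subst.
- move=> c1 c2 st st1 st1' t1 t1' _ IH1 _ IH2 t2 st2 ex2.
  inversion ex2 as [| | | |? ? ? sm ? ta tb exa exb| | |]; subst.
  by case: (IH1 _ _ exa) => ? ?; subst; case: (IH2 _ _ exb) => ? ?; subst.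
- move=> e c1 c2 st st' t _ IH t2 st2 ex2.
  inversion ex2 as [| | | | |? ? ? ? ? ta exa| |]; subst.
  by case: (IH _ _ exa) => ? ?; subst.
- by move=> e c st e0 t2 st2 ex2; inversion ex2; subst.
- move=> e c st st1 st1' t1 t1' ne0 _ IH1 _ IH2 t2 st2 ex2.
  inversion ex2 as [| | | | | | |? ? ? sm ? ta tb _ exa exb]; subst => //.
  by case: (IH1 _ _ exa) => ? ?; subst; case: (IH2 _ _ exb) => ? ?; subst.
Qed.

Definition word_size (w : seq nat) : nat := \sum_(x <- w) bits x.

(* A search problem: given x, produce some y with R x y, or report that there
   is none. *)
Definition encode_answer (Y : Type) (encY : Y -> seq nat) (a : option Y) :
    seq nat :=
  if a is Some y then 1%N :: encY y else [:: 0%N].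

Definition correct_answer (Y : Type) (P : Y -> Prop) (a : option Y) : Prop :=
  if a is Some y then P y else ~ exists y, P y.

Definition poly_time_solvable (X : Type) (Y : X -> Type)
    (encX : X -> seq nat) (encY : forall x, Y x -> seq nat)
    (R : forall x, Y x -> Prop) : Prop :=
  exists (prog : cmd) (a b : nat), forall x : X,
  exists (t : nat) (st : state) (ans : option (Y x)),
    [/\ exec prog (init_state (encX x)) t st,
        t <= a * word_size (encX x) ^ b + a,
        out_of st = encode_answer (@encY x) ans
      & correct_answer (@R x) ans].

(* m, n, then r^1, ..., r^k, then s^1, ..., s^k. *)
Definition encode_instance (k : nat) (I : instance k) : seq nat :=
  [:: nrows I, ncols I
    & flatten [seq tval (rproj I d) | d <- enum 'I_k]
      ++ flatten [seq tval (sproj I d) | d <- enum 'I_k]].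

(* Row-major order. *)
Definition encode_matrix (k : nat) (I : instance k) (M : candidate I) :
    seq nat :=
  [seq (M i j : nat) | i <- enum 'I_(nrows I), j <- enum 'I_(ncols I)].

(* The tiles are fixed and not part of the input. *)
Definition tomography_in_poly_time (k : nat) (T : 'I_k -> tile) : Prop :=
  @poly_time_solvable (instance k) (@candidate k) (@encode_instance k)
    (@encode_matrix k) (@is_solution k T).

(* Main.v *)
Require Import Defs.
From mathcomp Require Import all_boot all_order all_algebra.
From mathcomp Require Import finmap zify.
From Stdlib Require Import FunctionalExtensionality.

Set Implicit Arguments.
Unset Strict Implicit.
Unset Printing Implicit Defensive.

(** Fill the grid row by row. A column is free at row i when its remaining
    tiles have total height m - i; exactly the free columns must start a tile
    there, r^1_i of them the tile T_1. Give T_1 to the free columns with the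
    most copies of T_1 left. This is safe by an exchange argument: read the two
    columns of a wrongly ordered pair as words over the two tiles, hence as
    monotone lattice paths from a common origin. They leave the origin in
    opposite directions and end in the opposite order, so they meet; swapping
    the prefixes up to the meeting point changes neither the row projections
    nor the number of tiles of each kind in the columns.

    For the running time, every number stored by the algorithm is at most the
    largest input number (or 2), and all loops run over the rows or the
    columns, so the logarithmic cost is a polynomial in m and n times the bit
    length of the input. *)

(** * A loop language compiled to the random access machine *)

(** In a tiled column, the tiles starting from row [i] on fill everything below the top of the first
    of them, so their total height is [m - i] exactly when a tile starts at row [i]. The remaining
    counts thus force which columns start a tile; only its kind is a choice. Two free columns have
    the same remaining height, so having more copies of T_1 means having fewer of T_2: hence the
    opposite order of the ends of the two paths. At a meeting point both prefixes have the same
    number of tiles of each kind, hence the same height, and the swap moves each tile sideways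
    within its row. Failure shows up in three ways: the initial column heights are not [m], a chosen
    tile has no copy left, or a row receives a wrong number of tiles of some kind. Truncated
    subtraction would hide the second, so it is tested before counts decrease; the run is not
    interrupted, a flag remembers the failure. *)

Lemma bits_leq m n : m <= n -> bits m <= bits n.
Proof. by move=> le_mn; rewrite /bits ltnS leq_trunc_log. Qed.

Lemma ltn_2expbits n : n < 2 ^ bits n.
Proof. by rewrite /bits trunc_log_ltn. Qed.

Lemma bits_le n k : 0 < k -> n < 2 ^ k -> bits n <= k.
Proof.
move=> k_gt0 lt_n; rewrite /bits; case: n lt_n => [|n] lt_n; first by rewrite trunc_log0.
by rewrite -(@ltn_exp2l 2) // (leq_ltn_trans _ lt_n) // trunc_logP.
Qed.

Lemma bitsD m n : bits (m + n) <= bits m + bits n.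
Proof.
apply: bits_le => //; rewrite expnD.
have := ltn_2expbits m; have := ltn_2expbits n.
by move: (2 ^ _) (2 ^ _) => x y; nia.
Qed.

Lemma bitsM m n : bits (m * n) <= bits m + bits n.
Proof. by apply: bits_le => //; rewrite expnD ltn_mul ?ltn_2expbits. Qed.

(** Coefficient of [bits b], where [b] bounds the memory. A memory access counts 1 whatever its
    address, and a product costs no more than a sum because bit lengths add up in both cases. *)
Fixpoint evalK (e : expr) : nat :=
  match e with
  | Cst c => bits c
  | Defs.Mem _ => 1
  | Bin _ e1 e2 => evalK e1 + evalK e2
  end.

Fixpoint ecostK (e : expr) : nat :=
  match e with
  | Cst c => bits c
  | Defs.Mem e1 => ecostK e1 + evalK e1 + 1
  | Bin _ e1 e2 => ecostK e1 + ecostK e2 + evalK e1 + evalK e2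
  end.

Lemma bits_eval mu b e :
  (forall a, mu a <= b) -> bits (eval mu e) <= evalK e * bits b.
Proof.
move=> mu_b; elim: e => [c|e _|o e1 IH1 e2 IH2] /=.
- by rewrite leq_pmulr.
- by rewrite mul1n bits_leq.
- rewrite mulnDl; apply: leq_trans (leq_add IH1 IH2).
  case: o => /=; rewrite ?bitsD ?bitsM //.
  by apply: leq_trans (leq_addr _ _); rewrite bits_leq ?leq_subr.
Qed.

Lemma ecost_le mu b e :
  (forall a, mu a <= b) -> ecost mu e <= ecostK e * bits b.
Proof.
move=> mu_b; elim: e => [c|e IH|o e1 IH1 e2 IH2] /=.
- by rewrite leq_pmulr.
- by rewrite !mulnDl mul1n !leq_add ?bits_eval ?bits_leq.
- by rewrite !mulnDl !leq_add ?bits_eval.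
Qed.

Definition exprK (e : expr) : nat := ecostK e + evalK e.

Arguments exprK : simpl never.

Lemma exprK_le mu b e : (forall a, mu a <= b) ->
  ecost mu e + bits (eval mu e) <= exprK e * bits b.
Proof. by move=> mu_b; rewrite mulnDl leq_add ?ecost_le ?bits_eval. Qed.

(* A store consists of numbered arrays; a scalar is an array used at index 0.
   Entry [k] of array [t < 16] lives at address [16 * k + t]. *)
Definition store := nat -> nat -> nat.

Definition set_at (G : store) (t k v : nat) : store :=
  fun t' k' => if (t' == t) && (k' == k) then v else G t' k'.

Inductive aexpr :=
| ACst of nat
| AAt of nat & aexpr
| ABin of binop & aexpr & aexpr.

Inductive acmd :=
| ASet of nat & aexpr & aexpr
| ARead of nat & aexpr
| AWrite of aexpr
| ASeq of acmd & acmd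
| AIf of aexpr & acmd & acmd
| AFor of nat & nat & acmd.

Fixpoint aeval (G : store) (e : aexpr) : nat :=
  match e with
  | ACst c => c
  | AAt t e1 => G t (aeval G e1)
  | ABin o e1 e2 => bin_val o (aeval G e1) (aeval G e2)
  end.

Record astate := AState { sto : store; ain : seq nat; aout : seq nat }.

Definition aset (s : astate) (t k v : nat) : astate :=
  AState (set_at (sto s) t k v) (ain s) (aout s).

Fixpoint arun (c : acmd) (s : astate) : astate :=
  match c with
  | ASet t e1 e2 => aset s t (aeval (sto s) e1) (aeval (sto s) e2)
  | ARead t e =>
      AState (set_at (sto s) t (aeval (sto s) e) (head 0 (ain s)))
        (behead (ain s)) (aout s)
  | AWrite e => AState (sto s) (ain s) (rcons (aout s) (aeval (sto s) e))
  | ASeq c1 c2 => arun c2 (arun c1 s)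
  | AIf e c1 c2 => if aeval (sto s) e != 0 then arun c1 s else arun c2 s
  | AFor v b c1 =>
      iteri (sto s b 0) (fun k s' => aset (arun c1 s') v 0 k.+1) (aset s v 0 0)
  end.

Fixpoint assigned (c : acmd) : seq nat :=
  match c with
  | ASet t _ _ | ARead t _ => [:: t]
  | AWrite _ => [::]
  | ASeq c1 c2 | AIf _ c1 c2 => assigned c1 ++ assigned c2
  | AFor v _ c1 => v :: assigned c1
  end.

Lemma set_at_neq G t k v t' : t' != t -> set_at G t k v t' = G t'.
Proof. by rewrite /set_at => /negPf->. Qed.

Lemma arun_frame c s t : t \notin assigned c -> sto (arun c s) t = sto s t.
Proof.
elim: c s => /= [t' e1 e2|t' e|e|c1 IH1 c2 IH2|e c1 IH1 c2 IH2|v u c IH] s.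
- by rewrite inE; apply: set_at_neq.
- by rewrite inE; apply: set_at_neq.
- by [].
- by rewrite mem_cat negb_or => /andP[n1 n2]; rewrite IH2 // IH1.
- by rewrite mem_cat negb_or => /andP[n1 n2]; case: ifP => _; auto.
- rewrite inE negb_or => /andP[nv nc]; elim: (sto s u 0) => [|N IHN] /=.
    by rewrite set_at_neq.
  by rewrite set_at_neq // IH.
Qed.

(** * Translation into machine code *)

Definition addr (t : nat) (e : expr) : expr :=
  Bin OAdd (Bin OMul (Cst 16) e) (Cst t).

Fixpoint ecomp (e : aexpr) : expr :=
  match e with
  | ACst c => Cst c
  | AAt t e1 => Defs.Mem (addr t (ecomp e1))
  | ABin o e1 e2 => Bin o (ecomp e1) (ecomp e2)
  end.

Fixpoint ccomp (c : acmd) : cmd :=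
  match c with
  | ASet t e1 e2 => Store (addr t (ecomp e1)) (ecomp e2)
  | ARead t e => Read (addr t (ecomp e))
  | AWrite e => Write (ecomp e)
  | ASeq c1 c2 => Seq (ccomp c1) (ccomp c2)
  | AIf e c1 c2 => If (ecomp e) (ccomp c1) (ccomp c2)
  | AFor v b c1 =>
      let ve := addr v (Cst 0) in
      Seq (Store ve (Cst 0))
        (While (Bin OSub (Defs.Mem (addr b (Cst 0))) (Defs.Mem ve))
           (Seq (ccomp c1) (Store ve (Bin OAdd (Defs.Mem ve) (Cst 1)))))
  end.

Definition flat (G : store) (a : nat) : nat := G (a %% 16) (a %/ 16).

Definition flat_state (s : astate) : state :=
  State (flat (sto s)) (ain s) (aout s).

Fixpoint tags_ok (e : aexpr) : bool :=
  match e with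
  | ACst _ => true
  | AAt t e1 => (t < 16) && tags_ok e1
  | ABin _ e1 e2 => tags_ok e1 && tags_ok e2
  end.

(* Expressions whose value never exceeds the maximum of 2 and the stored
   values: assigning only such expressions keeps all numbers small. *)
Fixpoint tame (e : aexpr) : bool :=
  match e with
  | ACst c => c <= 2
  | AAt _ _ => true
  | ABin OSub e1 _ => tame e1
  | _ => false
  end.

(* Arrays 0 and 1 hold the two loop bounds and are never assigned. *)
Fixpoint wf (c : acmd) : bool :=
  match c with
  | ASet t e1 e2 => [&& 1 < t, t < 16, tags_ok e1, tags_ok e2 & tame e2]
  | ARead t e => [&& 1 < t, t < 16 & tags_ok e]
  | AWrite e => tags_ok e
  | ASeq c1 c2 => wf c1 && wf c2
  | AIf e c1 c2 => [&& tags_ok e, wf c1 & wf c2]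
  | AFor v b c1 => [&& 1 < v, v < 16, b < 2, v \notin assigned c1 & wf c1]
  end.

Lemma flat_addr G t k : t < 16 -> flat G (16 * k + t) = G t k.
Proof.
by move=> lt_t; rewrite /flat mulnC modnMDl divnMDl // modn_small // divn_small ?addn0.
Qed.

Lemma upd_flat G t k v : t < 16 ->
  upd (flat G) (16 * k + t) v = flat (set_at G t k v).
Proof.
move=> lt_t; apply: functional_extensionality => a; rewrite /upd /flat /set_at.
congr (if _ then _ else _); lia.
Qed.

Lemma eval_ecomp G e : tags_ok e -> eval (flat G) (ecomp e) = aeval G e.
Proof.
elim: e => [c|t e IH|o e1 IH1 e2 IH2] //=.
  by case/andP=> lt_t ok_e; rewrite flat_addr // IH.
by case/andP=> ok1 ok2; rewrite IH1 // IH2.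
Qed.

(** Depths are added, not maximised, over sequences and branches: the exponent only has to be a
    constant of the program, and a sum dominates both parts. *)
Fixpoint loop_depth (c : acmd) : nat :=
  match c with
  | ASeq c1 c2 | AIf _ c1 c2 => loop_depth c1 + loop_depth c2
  | AFor _ _ c1 => (loop_depth c1).+1
  | _ => 0
  end.

Definition storeK (e1 e2 : expr) : nat := exprK e1 + exprK e2.

Arguments storeK : simpl never.

Fixpoint costK (c : acmd) : nat :=
  match c with
  | ASet t e1 e2 => storeK (addr t (ecomp e1)) (ecomp e2)
  | ARead t e => exprK (addr t (ecomp e)) + 1
  | AWrite e => exprK (ecomp e)
  | ASeq c1 c2 => costK c1 + costK c2
  | AIf e c1 c2 => exprK (ecomp e) + (costK c1 + costK c2)
  | AFor v b c1 =>
      let ve := addr v (Cst 0) in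
      let test := Bin OSub (Defs.Mem (addr b (Cst 0))) (Defs.Mem ve) in
      storeK ve (Cst 0) + exprK test
      + (costK c1 + storeK ve (Bin OAdd (Defs.Mem ve) (Cst 1)))
  end.

(** [N] bounds the iterations and [b] the values: the cost may be polynomial in the former but only
    linear in the bit length of the latter. *)
Record bounded (N b : nat) (s : astate) : Prop := Bounded {
  bounded_sto : forall t k, sto s t k <= b;
  bounded_in : all (fun x => x <= b) (ain s);
  bounded_loop0 : sto s 0 0 <= N;
  bounded_loop1 : sto s 1 0 <= N }.

Lemma bounded_flat N b s : bounded N b s -> forall a, flat (sto s) a <= b.
Proof. by move=> bs a; apply: bounded_sto bs _ _. Qed.

Lemma bounded_aset N b s t k v :
  1 < t -> v <= b -> bounded N b s -> bounded N b (aset s t k v).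
Proof.
move=> lt1t le_vb [bs bi b0 b1]; split=> //= [t' k'||]; rewrite /set_at.
- by case: ifP.
- by case: eqP => // eq_t; rewrite -eq_t in lt1t.
- by case: eqP => // eq_t; rewrite -eq_t in lt1t.
Qed.

Lemma tame_le G b e :
  2 <= b -> (forall t k, G t k <= b) -> tame e -> aeval G e <= b.
Proof.
move=> le2b Gb; elim: e => [c|t e _|[] e1 IH1 e2 _] //= ok.
  exact: leq_trans ok le2b.
by apply: leq_trans (leq_subr _ _) _; apply: IH1.
Qed.

Lemma exec_store G w o t e1 e2 N b : t < 16 -> tags_ok e1 ->
  bounded N b (AState G w o) ->
  exists2 T, exec (Store (addr t (ecomp e1)) e2) (flat_state (AState G w o)) T
      (flat_state (aset (AState G w o) t (aeval G e1) (eval (flat G) e2)))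
    & T <= storeK (addr t (ecomp e1)) e2 * bits b.
Proof.
move=> lt_t ok1 bd; have fb := bounded_flat bd; rewrite /flat_state /=.
rewrite -upd_flat // -(eval_ecomp _ ok1); eexists; first exact: ExStore.
rewrite /storeK mulnDl -(addnA (ecost _ _ + _)) addnACA.
by rewrite leq_add // exprK_le.
Qed.

Lemma wf_assigned c t : wf c -> t \in assigned c -> 1 < t.
Proof.
elim: c => /= [t' e1 e2|t' e|e|c1 IH1 c2 IH2|e c1 IH1 c2 IH2|v u c IH] //.
- by case/andP=> lt1 _; rewrite inE => /eqP->.
- by case/andP=> lt1 _; rewrite inE => /eqP->.
- by case/andP=> wf1 wf2; rewrite mem_cat => /orP[]; auto.
- by case/and3P=> _ wf1 wf2; rewrite mem_cat => /orP[]; auto.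
- by case/and5P=> lt1 _ _ _ wfc; rewrite inE => /predU1P[->|]; auto.
Qed.

(** Cost and boundedness go together, since a command is charged in the state left by its
    predecessors. Intermediate values such as products may exceed [b]; their bit length is still a
    constant multiple of [bits b], and only stored values have to be tame. *)
Lemma ccomp_sound c s N b :
  2 <= b -> N <= b -> wf c -> bounded N b s ->
  (exists2 T, exec (ccomp c) (flat_state s) T (flat_state (arun c s))
      & T <= costK c * N.+1 ^ loop_depth c * bits b) /\
  bounded N b (arun c s).
Proof.
move=> le2b leNb; elim: c s => /= [t e1 e2|t e|e|c1 IH1 c2 IH2|e c1 IH1 c2 IH2|v u c IH] s.
- case/and5P=> lt1t lt_t ok1 ok2 tame2 bd; split.
  + case: s bd => G w o bd.
    have [T exT leT] := exec_store (ecomp e2) lt_t ok1 bd.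
    by exists T; rewrite ?expn0 ?muln1 // -(eval_ecomp _ ok2).
  + by apply: bounded_aset => //; apply: tame_le => //; apply: bounded_sto bd.
- case/and3P=> lt1t lt_t ok_e bd; have fb := bounded_flat bd.
  have le_h : head 0 (ain s) <= b.
    by case: (ain s) (bounded_in bd) => //= x w /andP[].
  split.
  + rewrite /flat_state /= -upd_flat // -(eval_ecomp _ ok_e).
    eexists; first exact: ExRead.
    by rewrite expn0 muln1 mulnDl mul1n leq_add ?bits_leq // exprK_le.
  + have [bs bi b0 b1] := @bounded_aset N b s t (aeval (sto s) e) _ lt1t le_h bd.
    by split=> //=; case: (ain s) (bounded_in bd) => //= x w /andP[].
- move=> ok_e bd; have fb := bounded_flat bd; split=> //.
  + rewrite /flat_state /= -(eval_ecomp _ ok_e).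
    eexists; first exact: ExWrite.
    by rewrite expn0 muln1 exprK_le.
  + by case: bd.
- case/andP=> wf1 wf2 bd; have [[T1 ex1 le1] bd1] := IH1 s wf1 bd.
  have [[T2 ex2 le2] bd2] := IH2 _ wf2 bd1; split=> //.
  + exists (T1 + T2); first exact: ExSeq ex1 ex2.
    rewrite mulnDl mulnDl leq_add //.
      by apply: leq_trans le1 _; rewrite leq_mul2r leq_mul2l leq_pexp2l ?leq_addr ?orbT.
    by apply: leq_trans le2 _; rewrite leq_mul2r leq_mul2l leq_pexp2l ?leq_addl ?orbT.
- case/and3P=> ok_e wf1 wf2 bd; have fb := bounded_flat bd.
  have [[T1 ex1 le1] bd1] := IH1 s wf1 bd.
  have [[T2 ex2 le2] bd2] := IH2 s wf2 bd.
  have ee := eval_ecomp (sto s) ok_e.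
  have X (T T' d d' K K' : nat) : T <= K * N.+1 ^ d * bits b -> d <= d' -> K <= K' ->
     ecost (flat (sto s)) (ecomp e) + bits (eval (flat (sto s)) (ecomp e)) + T <=
     (exprK (ecomp e) + K') * N.+1 ^ d' * bits b.
    move=> leT led leK; rewrite mulnDl mulnDl leq_add //.
      rewrite mulnAC -[leqLHS]muln1 leq_mul ?expn_gt0 //.
      exact: exprK_le.
    by apply: leq_trans leT _; rewrite leq_mul2r leq_mul ?orbT // leq_pexp2l.
  split.
  + case: ifP => E.
      eexists; first by apply: ExIf; rewrite /= ee E; exact: ex1.
      by apply: X le1 _ _; rewrite ?leq_addr.
    eexists; first by apply: ExIf; rewrite /= ee E; exact: ex2.
    by apply: X le2 _ _; rewrite ?leq_addl.
  + by case: ifP.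
case/and5P=> lt1v lt_v ltu2 nv wfc bd.
set f := (fun k s' => aset (arun c s') v 0 k.+1).
have ne_uv : (u == v) = false by lia.
have lt_u : u < 16 by lia.
have le_uN : sto s u 0 <= N by case: bd => ? ? ? ?; case: u ltu2 {ne_uv lt_u} => [|[|]].
set n := sto s u 0.
have invP k : k <= n -> [/\ bounded N b (iteri k f (aset s v 0 0)),
    sto (iteri k f (aset s v 0 0)) v 0 = k &
    forall t, t \notin v :: assigned c ->
      sto (iteri k f (aset s v 0 0)) t = sto s t].
  elim: k => [|k IHk] le_k.
    split; first exact: bounded_aset.
      by rewrite /= /set_at !eqxx.
    by move=> t; rewrite inE negb_or => /andP[nt _] /=; rewrite set_at_neq.
  have [bk vk frk] := IHk (ltnW le_k); have [_ bk'] := IH _ wfc bk.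
  split=> [||t nt] /=.
  + by apply: bounded_aset => //; lia.
  + by rewrite /set_at !eqxx.
  + have := nt; rewrite inE negb_or => /andP[ntv ntc].
    by rewrite set_at_neq // arun_frame // frk.
(* The induction is on the number [j] of iterations still to run, because [While] unfolds at the
   front whereas [iteri] unfolds at the back. *)
have loopP j : j <= n -> exists2 T,
    exec (While (Bin OSub (Defs.Mem (addr u (Cst 0))) (Defs.Mem (addr v (Cst 0))))
           (Seq (ccomp c) (Store (addr v (Cst 0))
              (Bin OAdd (Defs.Mem (addr v (Cst 0))) (Cst 1)))))
      (flat_state (iteri (n - j) f (aset s v 0 0))) T
      (flat_state (iteri n f (aset s v 0 0)))
    & T <= exprK (Bin OSub (Defs.Mem (addr u (Cst 0))) (Defs.Mem (addr v (Cst 0)))) * bits b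
         + j * ((exprK (Bin OSub (Defs.Mem (addr u (Cst 0))) (Defs.Mem (addr v (Cst 0)))) + (costK c
             + storeK (addr v (Cst 0)) (Bin OAdd (Defs.Mem (addr v (Cst 0))) (Cst 1))))
           * N.+1 ^ loop_depth c * bits b).
  set test := Bin OSub _ _; set inc := Bin OAdd _ _.
  have testP k : k <= n ->
      let mu := flat (sto (iteri k f (aset s v 0 0))) in
      eval mu test = n - k /\
      ecost mu test + bits (eval mu test) <= (exprK test) * bits b.
    move=> le_k mu; have [bk vk frk] := invP k le_k; have fb := bounded_flat bk.
    split; last exact: exprK_le.
    rewrite /mu /test; move: (iteri k f _) vk frk => s' vk frk.
    rewrite [eval _ _](_ : _ = sto s' u 0 - sto s' v 0).
      (* Each test reads the loop bound again; as [u < 2], the body never assigns it and it keeps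
         its initial value. *)
      rewrite vk frk // inE ne_uv; apply/negP => /= uc.
      by have := wf_assigned wfc uc; lia.
    have := @eval_ecomp (sto s') (ABin OSub (AAt u (ACst 0)) (AAt v (ACst 0))).
    by rewrite /= lt_u lt_v => ->.
  elim: j => [|j IHj] le_j.
    rewrite subn0; have [te tc] := testP n (leqnn _).
    eexists; first by apply: ExWhileEnd; have := te; rewrite subnn.
    by rewrite mul0n addn0.
  have [T2 ex2 le2] := IHj (ltnW le_j).
  have le_k : n - j.+1 <= n by lia.
  have [te tc] := testP _ le_k.
  have [bk vk frk] := invP _ le_k.
  have [[T1 ex1 le1] bk1] := IH _ wfc bk.
  set s' := iteri (n - j.+1) f _ in te tc bk vk frk T1 ex1 le1 bk1 *.
  have [T3 ex3 le3] : exists2 T, exec (Store (addr v (Cst 0)) inc)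
     (flat_state (arun c s')) T (flat_state (iteri (n - j) f (aset s v 0 0)))
     & T <= storeK (addr v (Cst 0)) inc * bits b.
    rewrite (_ : n - j = (n - j.+1).+1) ?iteriS -/s' /f; last by lia.
    move: bk1 (congr1 (fun g => g 0) (arun_frame s' nv)); rewrite vk; case: (arun c s') => G w o bk1 /= vk1.
    have [T ex le] := @exec_store G w o v (ACst 0) inc N b lt_v isT bk1.
    exists T => //; move: ex; rewrite (_ : eval _ inc = (n - j.+1).+1) //.
    have := @eval_ecomp G (ABin OAdd (AAt v (ACst 0)) (ACst 1)).
    by rewrite /= lt_v => -> //=; rewrite vk1 addn1.
  eexists.
    apply: ExWhileStep; first by have := te; rewrite /= => ->; lia.
    apply: ExSeq ex1 ex3.
    exact: ex2.
  have : 0 < N.+1 ^ loop_depth c by rewrite expn_gt0.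
  move=> E_gt0; apply: leq_trans (leq_add (leq_add tc (leq_add le1 le3)) le2) _.
  move: E_gt0; move: (bits b) (N.+1 ^ loop_depth c) (storeK (addr v (Cst 0)) inc) (exprK test) (costK c) => L E x y z E_gt0.
  have := leq_pmulr (x * L) E_gt0; rewrite mulnAC.
  have := leq_pmulr (y * L) E_gt0; rewrite mulnAC.
  rewrite mulSn !mulnDl; lia.
split; last by have [] := invP n (leqnn _).
have [T0 ex0 le0] : exists2 T, exec (Store (addr v (Cst 0)) (Cst 0)) (flat_state s) T
   (flat_state (aset s v 0 0)) & T <= storeK (addr v (Cst 0)) (Cst 0) * bits b.
  by case: s bd {n le_uN f invP loopP} => G w o bd;
    apply: (@exec_store G w o v (ACst 0) (Cst 0) N b lt_v isT bd).
have [T1 ex1 le1] := loopP n (leqnn _).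
exists (T0 + T1).
  by apply: ExSeq ex0 _; move: ex1; rewrite subnn.
have E1 : 0 < N.+1 ^ loop_depth c by rewrite expn_gt0.
have EN : N.+1 ^ (loop_depth c).+1 = N.+1 ^ loop_depth c + N * N.+1 ^ loop_depth c.
  by rewrite expnS mulSn.
rewrite EN; move: le0 le1 le_uN E1; rewrite -/n.
move: (N.+1 ^ _) (bits b) (storeK _ _) (storeK _ _) (exprK _) (costK c) => E L a2 a1 a3 a5.
move=> le0 le1 le_nN E1.
apply: (@leq_trans (a1 * L + (a3 * L + N * ((a3 + (a5 + a2)) * E * L)))); last by nia.
apply: leq_add => //; apply: leq_trans le1 _.
by rewrite leq_add2l leq_mul2r le_nN orbT.
Qed.


(** * The greedy choice *)

Section Bars.

Variable p : bool -> nat.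
Hypothesis p_gt0 : forall c, 0 < p c.

Definition height (w : seq bool) : nat := \sum_(c <- w) p c.

(* The word [w] lists the tiles of a column from top to bottom, the last one
   ending at the bottom of the grid; [starts w c z] tells whether a tile of
   kind [c] starts at distance [z] from the bottom. *)
Fixpoint starts (w : seq bool) (c : bool) (z : nat) : nat :=
  if w is d :: w' then (d == c) && (height w == z) + starts w' c z else 0.

Lemma height_cons c w : height (c :: w) = p c + height w.
Proof. by rewrite /height big_cons. Qed.

Lemma height_cat u v : height (u ++ v) = height u + height v.
Proof. by rewrite /height big_cat. Qed.

Lemma height_count w :
  height w = p true * count_mem true w + p false * count_mem false w.
Proof.
elim: w => [|c w IH]; first by rewrite /height big_nil !muln0.
by rewrite height_cons IH; case: c => /=; lia.
Qed.

Lemma starts_gt w c z : height w < z -> starts w c z = 0.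
Proof.
elim: w => [|d w IH] //= lt_z; rewrite ltn_eqF // andbF IH //.
by move: lt_z; rewrite height_cons; lia.
Qed.

(** Positions are measured from the bottom, so the letters of [u] start at the same places above any
    tail of the same height. *)
Lemma starts_swap_tail u v v' c z : height v = height v' ->
  starts (u ++ v) c z + starts v' c z = starts (u ++ v') c z + starts v c z.
Proof.
move=> hv; elim: u => [|d u IH] /=; first exact: addnC.
by rewrite !height_cons !height_cat hv -!addnA IH.
Qed.

(** * Exchange of prefixes between two words *)

Lemma count_split (u : seq bool) :
  count_mem true u + count_mem false u = size u.
Proof. by elim: u => //= -[] u <-; lia. Qed.

(* Both paths are followed at the same number of letters, not at the same
   height: heights need not agree before the paths meet. *)
Lemma common_prefix u v :
  count_mem true (true :: v) <= count_mem true (false :: u) ->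
  count_mem false (false :: u) <= count_mem false (true :: v) ->
  exists k, [/\ k <= size u, k <= size v &
    forall c, count_mem c (take k.+1 (false :: u)) =
              count_mem c (take k.+1 (true :: v))].
Proof.
move=> le_t le_f.
pose a k := count_mem true (take k.+1 (false :: u)).
pose b k := count_mem true (take k.+1 (true :: v)).
pose K := minn (size u) (size v).
have step k (x : seq bool) : count_mem true (take k x) <= count_mem true (take k.+1 x)
     <= (count_mem true (take k x)).+1.
  rewrite -[k.+1]addn1 takeD count_cat leq_addr /= -[X in _ <= X]addn1 leq_add2l.
  by case: (drop k x) => [|y l] //=; rewrite take0 addn0 leq_b1.
(* Once the shorter word is exhausted the order is reversed: by [le_t] if it is the first word, and
   by [le_f] together with the equality of lengths if it is the second. *)
have K_ok : b K <= a K.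
  rewrite /a /b /K; case: (leqP (size u) (size v)) => le_uv.
    rewrite [take _ (false :: u)]take_oversize //; apply: leq_trans le_t.
    by rewrite -[X in _ <= count_mem true X](cat_take_drop (size u).+1) count_cat leq_addr.
  rewrite [take _ (true :: v)]take_oversize //.
  have c1 := count_split (take (size v).+1 (false :: u)).
  have c2 := count_split (true :: v).
  rewrite size_takel /= in c1; last by lia.
  suff : count_mem false (take (size v).+1 (false :: u)) <= count_mem false (true :: v).
    by move: c1 c2; rewrite /=; lia.
  apply: leq_trans le_f.
  by rewrite -[X in _ <= count_mem false X](cat_take_drop (size v).+1) count_cat leq_addr.
have ex_k : exists k, b k <= a k by exists K.
case: (ex_minnP ex_k) => k le_k min_k.
have kK : k <= K by apply: min_k.
exists k; split; [by rewrite /K in kK; lia | by rewrite /K in kK; lia |].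
(* The counts start at 0 against 1 and grow by at most one per letter, so at the first index with
   [b k <= a k] they cannot have jumped past each other. *)
have eqt : a k = b k.
  apply/eqP; rewrite eqn_leq le_k andbT.
  case: k le_k min_k kK => [|k] le_k min_k kK; first by rewrite /a /b /= !take0.
  have lt_k : a k < b k.
    by rewrite ltnNge; apply/negP => /min_k; rewrite ltnn.
  have /andP[_ st_a] := step k.+1 (false :: u).
  have /andP[st_b _] := step k.+1 (true :: v).
  by rewrite /a /b in lt_k *; apply: leq_trans st_a _; apply: leq_trans lt_k st_b.
have su := count_split (take k.+1 (false :: u)).
have sv := count_split (take k.+1 (true :: v)).
rewrite !size_takel /= in su sv; [|by rewrite /K in kK; lia..].
rewrite /a /b /= in eqt.
by case=> /=; lia.
Qed.

Lemma word_exchange u v : height u = height v ->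
    ohead u = Some false -> ohead v = Some true ->
    count_mem true v <= count_mem true u ->
  exists u' v',
    [/\ ohead u' = Some true, ohead v' = Some false,
        forall c, count_mem c u' = count_mem c u,
        forall c, count_mem c v' = count_mem c v
      & forall c z, starts u' c z + starts v' c z = starts u c z + starts v c z].
Proof.
case: u v => [|[] u] [|[] v] // hh _ _ le_t.
(* At equal total height, at least as many tiles of kind [true] leave room for at most as many of
   kind [false]. *)
have le_f : count_mem false (false :: u) <= count_mem false (true :: v).
  have := p_gt0 true; have := p_gt0 false; move: hh le_t; rewrite !height_count.
  by move: (p true) (p false) (count_mem true _) (count_mem true _)
    (count_mem false _) (count_mem false _) => *; nia.
have [k [ku kv ck]] := common_prefix le_t le_f.
set u0 := false :: u in hh le_t le_f ck *; set v0 := true :: v in hh le_t le_f ck *.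
exists (take k.+1 v0 ++ drop k.+1 u0), (take k.+1 u0 ++ drop k.+1 v0).
have eq_ht : height (take k.+1 u0) = height (take k.+1 v0).
  by rewrite !height_count !ck.
have eq_hd : height (drop k.+1 u0) = height (drop k.+1 v0).
  apply/eqP; rewrite -(eqn_add2l (height (take k.+1 u0))) {2}eq_ht.
  by rewrite -!height_cat !cat_take_drop hh.
split=> // [c|c|c z].
- by rewrite count_cat -ck -count_cat cat_take_drop.
- by rewrite count_cat ck -count_cat cat_take_drop.
have := @starts_swap_tail (take k.+1 v0) _ _ c z eq_hd.
have := @starts_swap_tail (take k.+1 u0) _ _ c z (esym eq_hd).
rewrite !cat_take_drop; lia.
Qed.

(** * Sorting the columns that start a tile in one row *)

Section Greedy.

Variable n : nat.

Implicit Types (C R : bool -> nat -> nat) (z r : nat).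

(* [C c j] tiles of kind [c] remain to be placed in column [j], and
   [R c z] of them must start at distance [z] from the bottom. *)
Definition fits z C R (w : 'I_n -> seq bool) : Prop :=
  [/\ forall c (j : 'I_n), count_mem c (w j) = C c j,
      forall j, height (w j) <= z
    & forall c y, 0 < y <= z -> \sum_(j < n) starts (w j) c y = R c y].

Definition col_height C (j : nat) : nat := p true * C true j + p false * C false j.

Definition free z C (j : nat) : bool := col_height C j == z.

(* For [j < n] this encodes the lexicographic order on the number of remaining
   tiles of kind [true], then on the column index. *)
Definition key C (j : nat) : nat := C true j * n + (n - j).

Definition rank z C (j : nat) : nat :=
  \sum_(k < n) (free z C k && (key C j < key C k)).

(** A single comparison decides between both kinds, so that every free column receives exactly one
    tile. *)
Definition pick z r C (c : bool) (j : nat) : bool := free z C j && ((rank z C j < r) == c).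

Definition left_after z r C : bool -> nat -> nat :=
  fun c j => C c j - pick z r C c j.

Lemma key_le C (j k : 'I_n) : key C k <= key C j -> C true k <= C true j.
Proof.
rewrite /key => le_kj; rewrite leqNgt; apply/negP => lt_jk.
have := ltn_ord k; have : C true j * n + n <= C true k * n by rewrite -mulSnr leq_mul2r lt_jk orbT.
lia.
Qed.

Lemma key_inj C (j k : 'I_n) : key C k = key C j -> k = j.
Proof.
move=> eq_k; have e : C true k = C true j.
  by apply/eqP; rewrite eqn_leq !key_le ?eq_k.
by apply: val_inj => /=; have := ltn_ord k; have := ltn_ord j; move: eq_k; rewrite /key e; lia.
Qed.

Lemma sum_exchange (F G : 'I_n -> nat) j k : j != k ->
    (forall i, i != j -> i != k -> F i = G i) ->
  \sum_i F i + (G j + G k) = \sum_i G i + (F j + F k).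
Proof.
move=> ne_jk eqFG.
rewrite (bigD1 j) //= (bigD1 k) 1?eq_sym //= [X in _ = X + _](bigD1 j) //=.
rewrite [X in _ = _ + X + _](bigD1 k) 1?eq_sym //=.
rewrite (eq_bigr G); first by lia.
by move=> i /andP[]; apply: eqFG.
Qed.

Definition sorted_heads z C (w : 'I_n -> seq bool) : Prop :=
  forall j k : 'I_n, free z C j -> free z C k ->
    ohead (w j) = Some false -> ohead (w k) = Some true -> key C j < key C k.

(** Wrongly ordered pairs are exchanged one at a time. This terminates because the sum of the keys
    over the columns headed by [true] strictly increases, keys being distinct, and cannot exceed the
    sum of all keys. *)
Lemma fits_sorted z C R w :
  fits z C R w -> exists2 w', fits z C R w' & sorted_heads z C w'.
Proof.
pose wt (w : 'I_n -> seq bool) (j : 'I_n) := (ohead (w j) == Some true) * key C j.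
pose K := \sum_(j < n) key C j.
have wt_le w1 : \sum_j wt w1 j <= K.
  by apply: leq_sum => j _; rewrite /wt; case: eqP; rewrite ?mul1n.
have [d] := ubnP (K - \sum_j wt w j); elim: d w => // d IH w lt_d fw.
case: (boolP [exists j : 'I_n, exists k : 'I_n, [&& free z C j, free z C k,
   ohead (w j) == Some false, ohead (w k) == Some true & key C k <= key C j]]); last first.
  move=> no; exists w => // j k fj fk hj hk; rewrite ltnNge; apply/negP => le_k.
  by case/existsP: no; exists j; apply/existsP; exists k; rewrite fj fk hj hk.
case/existsP=> j /existsP[k /and5P[fj fk /eqP hj /eqP hk le_k]].
have ne_jk : j != k by apply/eqP => E; move: hj; rewrite E hk.
have ne_key : key C k != key C j by apply: contraNneq ne_jk => /key_inj->.
have [cw hw sw] := fw.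
have ht i : height (w i) = col_height C i by rewrite height_count !cw.
have hjk : height (w j) = height (w k) by rewrite !ht (eqP fj) (eqP fk).
have le_jk : count_mem true (w k) <= count_mem true (w j) by rewrite !cw key_le.
have [u [v [hu hv cu cv suv]]] := word_exchange hjk hj hk le_jk.
pose w' i := if i == j then u else if i == k then v else w i.
have w'j : w' j = u by rewrite /w' eqxx.
have w'k : w' k = v by rewrite /w' eq_sym (negPf ne_jk) eqxx.
have w'o i : i != j -> i != k -> w' i = w i by rewrite /w' => /negPf-> /negPf->.
have cw' c i : count_mem c (w' i) = C c i.
  by rewrite /w' -cw; case: eqP => [->|_]; last case: eqP => [->|].
apply: (IH w').
  have eqw i : i != j -> i != k -> wt w' i = wt w i by move=> *; rewrite /wt w'o.
  have := sum_exchange ne_jk eqw; have := wt_le w'.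
  have -> : wt w j = 0 by rewrite /wt hj.
  have -> : wt w k = key C k by rewrite /wt hk mul1n.
  have -> : wt w' j = key C j by rewrite /wt w'j hu mul1n.
  have -> : wt w' k = 0 by rewrite /wt w'k hv.
  lia.
split=> // [i|c y y_z].
  by rewrite height_count !cw' -/(col_height C i) -ht.
rewrite -sw //; have := suv c y.
have eqs i : i != j -> i != k -> starts (w' i) c y = starts (w i) c y.
  by move=> *; rewrite w'o.
have := sum_exchange ne_jk eqs; rewrite w'j w'k.
by move=> E1 E2; move: E1; rewrite E2 => /addIn.
Qed.

(** With sorted heads, the free columns headed by [true] are those of largest key and there are
    [R true z.+1] of them, so they are the ones picked. Dropping the heads of all free columns
    leaves a fitting family for the next row. *)
Lemma greedy_step z C R w : fits z.+1 C R w ->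
  [/\ forall c (j : 'I_n), pick z.+1 (R true z.+1) C c j -> 0 < C c j,
      forall c, \sum_(j < n) pick z.+1 (R true z.+1) C c j = R c z.+1
    & exists w', fits z (left_after z.+1 (R true z.+1) C) R w'].
Proof.
case/fits_sorted=> {}w [cw hw sw] srt.
have ht i : height (w i) = col_height C i by rewrite height_count !cw.
have startsE c j : starts (w j) c z.+1 = free z.+1 C j && (ohead (w j) == Some c).
  rewrite /free -ht; have := hw j; case: (w j) => [|d u] /=; first by rewrite andbF.
  rewrite height_cons => le_z; rewrite starts_gt; last by have := p_gt0 d; lia.
  by rewrite addn0 andbC.
have headE (j : 'I_n) : free z.+1 C j -> ohead (w j) = Some (ohead (w j) == Some true).
  rewrite /free -ht; case: (w j) => [|[] u] //.
  by rewrite /height big_nil.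
have sumR c : \sum_(j < n) (free z.+1 C j && (ohead (w j) == Some c)) = R c z.+1.
  by rewrite -sw ?ltn0Sn ?leqnn //; apply: eq_bigr => j _; rewrite startsE.
have pickE c (j : 'I_n) : pick z.+1 (R true z.+1) C c j = free z.+1 C j && (ohead (w j) == Some c).
  rewrite /pick; case fj: (free z.+1 C j) => //=.
  suff -> : (rank z.+1 C j < R true z.+1) = (ohead (w j) == Some true).
    by rewrite {2}headE //; case: c; case: (_ == Some true).
  rewrite /rank -(sumR true); case hj: (ohead (w j) == Some true).
    (* Column [j] counts among those headed by [true] but not in its own rank; this is where the
       strict inequality comes from. *)
    rewrite (bigD1 j) //= ltnn andbF [X in _ < X](bigD1 j) //= fj hj /= ltnS.
    apply: leq_sum => k _; case fk: (free _ _ k) => //=.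
    case: ltnP => //= lt_jk; case hk: (ohead (w k) == Some true) => //.
    have := srt k j fk fj; rewrite (headE k) // hk (eqP hj) => /(_ erefl erefl).
    by move/ltnW; rewrite leqNgt lt_jk.
  apply/negbTE; rewrite -leqNgt; apply: leq_sum => k _.
  case fk: (free _ _ k) => //=; case hk: (ohead (w k) == Some true) => //.
  by rewrite srt // ?(eqP hk) // headE ?hj.
have posC c (j : 'I_n) : pick z.+1 (R true z.+1) C c j -> 0 < C c j.
  by rewrite pickE -cw => /andP[_]; case: (w j) => [|d u] //= /eqP[->]; rewrite eqxx.
split=> // [c|].
  by rewrite -[RHS]sumR; apply: eq_bigr => j _; rewrite pickE.
exists (fun j : 'I_n => if free z.+1 C j then behead (w j) else w j); split.
- move=> c j; rewrite /left_after pickE -cw; case: ifP => _ /=; last by rewrite subn0.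
  by case: (w j) => [|d u] //=; rewrite /eq_op /= addKn.
- move=> j; case: ifP; rewrite /free -ht.
    case: (w j) (hw j) => [|d u] /=; first by rewrite /height big_nil.
    by rewrite height_cons; have := p_gt0 d; lia.
  by have := hw j; lia.
- move=> c y /andP[y0 yz]; rewrite -sw ?y0 ?leqW //.
  apply: eq_bigr => j _; case: ifP => //; rewrite /free -ht.
  case: (w j) => [|d u] //= /eqP->.
  by rewrite gtn_eqF ?andbF.
Qed.

End Greedy.


(** ** Columns as words *)

Definition len (o : option bool) : nat := if o is Some c then p c else 0.

(* [f i] is the kind of the tile whose top cell is in row [i], if any. *)
Definition rest (f : nat -> option bool) (m i : nat) : nat :=
  \sum_(i <= k < m) len (f k).

Lemma restS f m i : i < m -> rest f m i = len (f i) + rest f m i.+1.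
Proof. by move=> lt_i; rewrite /rest big_ltn. Qed.

Lemma rest_geq f m i : m <= i -> rest f m i = 0.
Proof. by move=> le_m; rewrite /rest big_geq. Qed.

Lemma rest_cat f m i k : i <= k -> k <= m ->
  rest f m i = \sum_(i <= x < k) len (f x) + rest f m k.
Proof. by move=> le_ik le_km; rewrite /rest (big_cat_nat le_ik le_km). Qed.

Lemma down_ind (P : nat -> Prop) m :
    P m -> (forall i, i < m -> P i.+1 -> P i) ->
  forall i, i <= m -> P i.
Proof.
move=> Pm Pstep i le_i; rewrite -(subKn le_i); elim: (m - i) (leq_subr i m) => [|d IH] le_d.
  by rewrite subn0.
apply: Pstep; first by lia.
by rewrite (_ : (m - d.+1).+1 = m - d); [apply: IH; lia | lia].
Qed.

(** Arithmetic form of an exact tiling of one column. The equality [i + rest f m i == m] is the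
    condition [free] of the greedy choice, which sees remaining counts and not positions. *)
Definition packed (f : nat -> option bool) (m : nat) : Prop :=
  rest f m 0 = m /\ forall i, i < m ->
    i + rest f m i <= m /\ (f i != None) = (i + rest f m i == m).

Definition tiles_column (f : nat -> option bool) (m : nat) : Prop :=
  (forall i k c, i < k < m -> f i = Some c -> f k != None -> i + p c <= k) /\
  (forall x, (exists i c, [/\ i < m, f i = Some c & i <= x < i + p c]) <-> x < m).

(** A tile starting at [i] ends where the total of the later ones begins, so it cannot overlap them.
    A row [x] is covered by the last tile starting at or above it: nothing starts between that tile
    and [x], and what starts after [x] fits below [x]. *)
Lemma packed_tiles f m : packed f m -> tiles_column f m.
Proof.
case=> rest0 pk; have at_start i c : i < m -> f i = Some c -> i + p c + rest f m i.+1 = m.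
  move=> lt_i fi; have [_] := pk i lt_i; rewrite fi restS // fi /= => /esym/eqP.
  by rewrite addnA.
split=> [i k c /andP[lt_ik lt_km] fi fk|x].
  have := at_start i c (ltn_trans lt_ik lt_km) fi.
  rewrite (rest_cat f lt_ik (ltnW lt_km)).
  by have [_] := pk k lt_km; rewrite fk => /esym/eqP; lia.
split=> [[i [c [lt_i fi /andP[_ lt_x]]]]|lt_x].
  by apply: leq_trans lt_x _; rewrite -(at_start i c lt_i fi) leq_addr.
have ex_i : exists i, (i <= x) && (f i != None).
  by exists 0; have [_ ->] := pk 0 (leq_ltn_trans (leq0n x) lt_x); rewrite rest0 /=.
have ub i : (i <= x) && (f i != None) -> i <= x by case/andP.
case: (ex_maxnP ex_i ub) => i /andP[le_ix fi] max_i.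
case fiE: (f i) fi => [c|] // _; exists i, c; split=> //; first exact: leq_ltn_trans lt_x.
have := at_start i c (leq_ltn_trans le_ix lt_x) fiE.
rewrite (@rest_cat f m i.+1 x.+1) // big_nat_cond big1 => [|k]; last first.
  case/andP=> /andP[lt_ik le_kx] _; case fk: (f k) => //.
  by have := max_i k; rewrite fk -ltnS le_kx => /(_ isT); rewrite leqNgt lt_ik.
rewrite add0n le_ix /=.
move: lt_x; rewrite leq_eqVlt => /predU1P[Ex|/pk[]]; last by lia.
by rewrite rest_geq -?Ex //; lia.
Qed.

(** From a start, jump to the end of the tile: no tile starts strictly inside it, and the next row
    is either the bottom or again a start, because the tile covering it can begin neither earlier
    nor later. *)
Lemma tiles_packed f m : tiles_column f m -> packed f m.
Proof.
case=> disj cov.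
have start_rest i : i <= m -> i = m \/ f i != None -> rest f m i = m - i.
  have [d] := ubnP (m - i); elim: d i => // d IH i lt_d le_i.
  case=> [->|]; first by rewrite rest_geq // subnn.
  move: le_i; rewrite leq_eqVlt => /predU1P[->|lt_i]; first by rewrite rest_geq // subnn.
  case fi: (f i) => [c|] // _.
  have pc := p_gt0 c.
  (* The lowest cell [(i + p c).-1] of the tile is covered, hence lies in the column. *)
  have le_m : i + p c <= m.
    have /cov : exists i0 c0, [/\ i0 < m, f i0 = Some c0 & i0 <= (i + p c).-1 < i0 + p c0].
      by exists i, c; split=> //; lia.
    lia.
  rewrite restS // fi /= (@rest_cat f m i.+1 (i + p c)) //; last by lia.
  rewrite big_nat_cond big1 => [|k]; last first.
    case/andP=> /andP[lt_ik lt_k] _; case fk: (f k) => [e|] //.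
    by have := disj i k c; rewrite lt_ik (leq_trans lt_k) // fk => /(_ isT fi isT); rewrite leqNgt lt_k.
  rewrite add0n IH //; [by lia | by lia |].
  move: le_m; rewrite leq_eqVlt => /predU1P[|lt_m]; [by left | right].
  have [k [e [lt_k fk /andP[le_k lt_ke]]]] := (cov _).2 lt_m.
  case: (ltngtP k i) => [lt_ki|lt_ik|eq_k].
  - have := disj k i e; rewrite lt_ki lt_i fi => /(_ isT fk isT); lia.
  - move: le_k; rewrite leq_eqVlt => /predU1P[<-|lt_kx]; first by rewrite fk.
    have := disj i k c; rewrite lt_ik lt_k fk => /(_ isT fi isT); lia.
  - by move: lt_ke; move: fk; rewrite eq_k fi => -[<-]; rewrite ltnn.
have none_rest i : i < m -> f i = None -> i + rest f m i < m.
  (* The tile covering row [i] starts at some [k < i], where [rest f m k = m - k]; as it occupies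
     row [i] too, less than [m - i] is left from row [i] on. *)
  move=> lt_i fi; have [k [c [lt_k fk /andP[le_k lt_kc]]]] := (cov i).2 lt_i.
  have lt_ki : k < i by rewrite ltn_neqAle le_k andbT; apply/eqP => E; move: fk; rewrite E fi.
  have := start_rest k (ltnW lt_k); rewrite fk => /(_ (or_intror isT)).
  rewrite restS // fk /= (rest_cat f lt_ki (ltnW lt_i)); move: (rest _ _ _) (\sum_(_ <= _ < _) _).
  by lia.
split=> [|i lt_i].
  case: m start_rest {disj none_rest} cov => [|m] start_rest cov; first by rewrite rest_geq.
  rewrite start_rest ?subn0 //; right.
  have [k [c [lt_k fk /andP[le_k lt_kc]]]] := (cov 0).2 (ltn0Sn m).
  by move: le_k fk; rewrite leqn0 => /eqP-> ->.
case fi: (f i) => [c|] /=.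
  have -> : rest f m i = m - i by apply: start_rest; [exact: ltnW | right; rewrite fi].
  by rewrite subnKC ?eqxx // ltnW.
by have lt_r := none_rest i lt_i fi; rewrite ltn_eqF // ltnW.
Qed.

Definition word (f : nat -> option bool) (m i : nat) : seq bool :=
  pmap f (iota i (m - i)).

Lemma wordS f m i : i < m ->
  word f m i = if f i is Some c then c :: word f m i.+1 else word f m i.+1.
Proof. by move=> lt_i; rewrite /word -(subnSK lt_i) /=; case: (f i). Qed.

Lemma height_word f m i : i <= m -> height (word f m i) = rest f m i.
Proof.
move: i; apply: down_ind => [|i lt_i IH].
  by rewrite rest_geq // /word subnn /height big_nil.
by rewrite restS // wordS // -IH; case: (f i) => [c|] //; rewrite height_cons.
Qed.

Lemma count_word f m i c : i <= m ->
  count_mem c (word f m i) = \sum_(i <= x < m) (f x == Some c).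
Proof.
move: i; apply: down_ind => [|i lt_i IH]; first by rewrite big_geq // /word subnn.
by rewrite wordS // big_ltn // -IH; case: (f i).
Qed.

(** The word forgets the rows, but packing recovers them: the suffix that begins with the tile of
    row [i] has height [m - i]. *)
Lemma starts_word f m c x : packed f m -> x < m ->
  starts (word f m 0) c (m - x) = (f x == Some c).
Proof.
case=> _ pk lt_x.
have {lt_x}: forall i, i <= m -> i <= x ->
    starts (word f m i) c (m - x) = (f x == Some c).
  apply: down_ind => [|i lt_i IH le_ix]; first by rewrite leqNgt lt_x.
  have [le_m fiE] := pk i lt_i.
  have hw := @height_word f m i (ltnW lt_i).
  have hw1 := @height_word f m i.+1 lt_i.
  move: le_ix; rewrite leq_eqVlt => /predU1P[eq_x|lt_ix].
    subst x; case fi: (f i) fiE => [d|] fiE.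
      rewrite wordS // fi /=; move: hw; rewrite wordS // fi => ->.
      rewrite starts_gt ?addn0.
        by rewrite -(eqn_add2l i) subnKC 1?ltnW // -fiE andbT.
      by rewrite hw1; move: (esym fiE); rewrite restS // fi /=; have := p_gt0 d; lia.
    by rewrite starts_gt // hw; move: fiE => /esym/negbT; lia.
  rewrite wordS //; move: fiE hw; case fi: (f i) => [d|] fiE hw; last exact: IH.
  rewrite /= IH // -[d :: _](_ : word f m i = _); last by rewrite wordS ?fi.
  by rewrite hw (_ : (rest f m i == m - x) = false) ?andbF //; move/esym: fiE => /=; lia.
by apply.
Qed.

End Bars.

(** * The greedy choice iterated over all rows *)

Section Greedy_run.

Variable p : bool -> nat.
Hypothesis p_gt0 : forall c, 0 < p c.
Variables (m n : nat) (r s : bool -> nat -> nat).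

Fixpoint remaining (i : nat) : bool -> nat -> nat :=
  if i is i'.+1 then left_after p n (m - i') (r true i') (remaining i') else s.

Definition picked (i : nat) (c : bool) (j : nat) : bool :=
  pick p n (m - i) (r true i) (remaining i) c j.

Definition greedy_tile (i j : nat) : option bool :=
  if picked i true j then Some true
  else if picked i false j then Some false else None.

(** [left_after] truncates, so a pick from a column without copies would leave no trace in the
    counts; the first clause excludes it. *)
Definition greedy_row_ok (i : nat) : Prop :=
  (forall c j, j < n -> picked i c j -> 0 < remaining i c j) /\
  (forall c, \sum_(j < n) picked i c j = r c i).

Definition greedy_ok : Prop :=
  (forall j, j < n -> col_height p s j = m) /\
  (forall i, i < m -> greedy_row_ok i).

Lemma greedy_complete w :
  (forall j, j < n -> col_height p s j = m) ->
  fits (n := n) p m s (fun c z => r c (m - z)) w -> greedy_ok.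
Proof.
move=> hs fw; split=> //.
have fits_i i : i <= m -> exists w,
    fits (n := n) p (m - i) (remaining i) (fun c z => r c (m - z)) w.
  elim: i => [|i IH] lt_i; first by exists w; rewrite subn0.
  have [w1 fw1] := IH (ltnW lt_i).
  rewrite -(subnSK lt_i) in fw1; have [_ _] := greedy_step p_gt0 fw1.
  by rewrite /= (subnSK lt_i) subKn // ltnW.
move=> i lt_i; have [w1 fw1] := fits_i i (ltnW lt_i).
rewrite -(subnSK lt_i) in fw1; have [pos sums _] := greedy_step p_gt0 fw1.
rewrite /= (subnSK lt_i) (subKn (ltnW lt_i)) in pos sums.
split=> [c j lt_j|c]; first exact: (pos c (Ordinal lt_j)).
exact: sums.
Qed.

Lemma greedy_tileE i j c : (greedy_tile i j == Some c) = picked i c j.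
Proof.
rewrite /greedy_tile /picked /pick; case: free => //=.
by case: (_ < _); case: c.
Qed.

(** The remaining height of a column never exceeds [m - i]: a free column loses at least 1, any
    other is strictly below the bound. At row [m] nothing remains, so all tiles have been placed and
    the remaining heights are the values of [rest]. *)
Lemma greedy_sound : greedy_ok ->
  [/\ forall j, j < n -> packed p (fun i => greedy_tile i j) m,
      forall i c, i < m -> \sum_(j < n) (greedy_tile i j == Some c) = r c i
    & forall j c, j < n -> \sum_(0 <= i < m) (greedy_tile i j == Some c) = s c j].
Proof.
case=> hs ok.
have step i c j : i < m -> j < n ->
    remaining i c j = picked i c j + remaining i.+1 c j.
  move=> lt_i lt_j; have [pos _] := ok i lt_i; rewrite /= /left_after -/(picked i c j).
  by have := pos c j lt_j; case: (picked i c j) => [/(_ isT)|_] /=; lia.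
have tile_len i j : len p (greedy_tile i j) =
    p true * picked i true j + p false * picked i false j.
  rewrite -!greedy_tileE; case: greedy_tile => [[]|] /=; rewrite ?eqxx ?muln1 ?muln0 ?addn0 //.
have heightS i j : i < m -> j < n ->
    col_height p (remaining i) j = len p (greedy_tile i j) + col_height p (remaining i.+1) j.
  by move=> lt_i lt_j; rewrite /col_height !(step i) // tile_len; lia.
have someE i j : (greedy_tile i j != None) = (col_height p (remaining i) j == m - i).
  by rewrite /greedy_tile /picked /pick /free; case: (col_height _ _ _ == _) => //=; case: (_ < _).
have le_m i j : i <= m -> j < n -> i + col_height p (remaining i) j <= m.
  move=> le_i lt_j; elim: i le_i => [|i IH] lt_i; first by rewrite hs.
  have := IH (ltnW lt_i); have := heightS i j lt_i lt_j.
  have := someE i j; case: (greedy_tile i j) => [c|] /=; last by lia.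
  by move=> _ -> ; have := p_gt0 c; lia.
have end0 j : j < n -> col_height p (remaining m) j = 0.
  by move=> lt_j; have := le_m m j (leqnn m) lt_j; lia.
have restE j i : j < n -> i <= m ->
    rest p (fun i => greedy_tile i j) m i = col_height p (remaining i) j.
  move=> lt_j; move: i; apply: down_ind => [|i lt_i IH]; first by rewrite rest_geq // end0.
  by rewrite restS // IH (heightS i).
split=> [j lt_j|i c lt_i|j c lt_j].
- split=> [|i lt_i]; first by rewrite restE // hs.
  rewrite (restE j i lt_j (ltnW lt_i)); have le_i := le_m i j (ltnW lt_i) lt_j.
  by split=> //; rewrite someE; lia.
- have [_ sums] := ok i lt_i; rewrite -(sums c).
  by apply: eq_bigr => j _; rewrite greedy_tileE.
- have : forall i, i <= m ->
      \sum_(i <= x < m) (greedy_tile x j == Some c) = remaining i c j.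
    apply: down_ind => [|i lt_i IH].
      rewrite big_geq //; have := end0 j lt_j; rewrite /col_height.
      by have := p_gt0 true; have := p_gt0 false; case: c; nia.
    by rewrite big_ltn // IH greedy_tileE (step i).
  by move=> ->.
Qed.

End Greedy_run.

(** * From solutions of an instance to tilings of its columns *)

Lemma mem_shift_vbar q i j (x : cell) :
  (x \in shift (vbar q) i j) = (i <= x.1 < i + q) && (x.2 == j).
Proof.
apply/imfsetP/idP => [[y /= y_in ->]|/andP[/andP[le_i lt_i] /eqP x2]] /=.
  by move: y_in; rewrite mem_vbar_cells => /andP[lt_y /eqP->]; lia.
exists (x.1 - i, 0) => /=; last by case: x le_i lt_i x2 => a b /= ? ? ->; congr (_, _); lia.
by rewrite mem_vbar_cells /=; lia.
Qed.

Section Link.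

Variables (p1 p2 : nat) (hp1 : 0 < p1) (hp2 : 0 < p2).

Definition bar_height (c : bool) : nat := if c then p1 else p2.

(* Kind [true] is the tile of index 0, that is entry 1 of the matrix. *)
Definition kind (d : 'I_2) : bool := d == ord0.

Definition kind_ord (c : bool) : 'I_2 := if c then ord0 else ord_max.

Lemma kindK : cancel kind kind_ord.
Proof. by case=> [[|[|k]] lt_k] //; apply: val_inj. Qed.

Lemma kind_ordK : cancel kind_ord kind.
Proof. by case. Qed.

Definition decode (x : 'I_3) : option bool := omap kind (unlift ord0 x).

Lemma decode_lift d : decode (lift ord0 d) = Some (kind d).
Proof. by rewrite /decode liftK. Qed.

Lemma decodeP x c : decode x = Some c <-> x = lift ord0 (kind_ord c).
Proof.
rewrite /decode; case: unliftP => [d ->|->] /=.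
  split=> [[<-]|/lift_inj->]; by rewrite ?kindK ?kind_ordK.
by split.
Qed.

Lemma decode_eq x c : (decode x == Some c) = (x == lift ord0 (kind_ord c)).
Proof. by apply/eqP/eqP => /decodeP. Qed.

Lemma bar_height_gt0 c : 0 < bar_height c. Proof. by case: c. Qed.

Lemma tnth_kind d : tnth [tuple vbar p1; vbar p2] d = vbar (bar_height (kind d)).
Proof. by case: d => [[|[|k]] lt_k]. Qed.

Variable I : instance 2.

Definition col_tile (M : candidate I) (j : 'I_(ncols I)) (i : nat) : option bool :=
  obind (fun i' => decode (M i' j)) (insub i).

Lemma col_tileE M j (i : 'I_(nrows I)) : col_tile M j i = decode (M i j).
Proof. by rewrite /col_tile valK. Qed.

Lemma col_tileP M j i c : col_tile M j i = Some c ->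
  exists2 i' : 'I_(nrows I), val i' = i & M i' j = lift ord0 (kind_ord c).
Proof. by rewrite /col_tile; case: insubP => //= i' _ <- /decodeP E; exists i'. Qed.

Definition row_sum (c : bool) (i : nat) : nat := nth 0 (rproj I (kind_ord c)) i.
Definition col_sum (c : bool) (j : nat) : nat := nth 0 (sproj I (kind_ord c)) j.

(** Bars have width one, so disjointness and covering can be checked in each column separately; only
    the row projections couple the columns. *)
Lemma solutionP (M : candidate I) :
  is_solution (tnth [tuple vbar p1; vbar p2]) M <->
  [/\ forall j, tiles_column bar_height (col_tile M j) (nrows I),
      forall c (i : 'I_(nrows I)),
        \sum_(j < ncols I) (col_tile M j i == Some c) = row_sum c i
    & forall c (j : 'I_(ncols I)),
        \sum_(0 <= i < nrows I) (col_tile M j i == Some c) = col_sum c j].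
Proof.
have rowE c (i : 'I_(nrows I)) : \sum_(j < ncols I) (col_tile M j i == Some c) =
    #|[set j | M i j == lift ord0 (kind_ord c)]|.
  rewrite -sum1dep_card [RHS]big_mkcond; apply: eq_bigr => j _.
  by rewrite col_tileE decode_eq; case: eqP.
have colE c (j : 'I_(ncols I)) : \sum_(0 <= i < nrows I) (col_tile M j i == Some c) =
    #|[set i | M i j == lift ord0 (kind_ord c)]|.
  rewrite big_mkord -sum1dep_card [RHS]big_mkcond; apply: eq_bigr => i _.
  by rewrite col_tileE decode_eq; case: eqP.
split=> [[disj cov rows cols]|[col rows cols]].
  split=> [j|c i|c j]; last 2 first.
  - by rewrite rowE -rows (tnth_nth 0).
  - by rewrite colE -cols (tnth_nth 0).
  split=> [i k c /andP[lt_ik lt_km] fi|x].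
    case fk: (col_tile M j k) => [e|] // _.
    have [i' Ei Mi] := col_tileP fi; have [k' Ek Mk] := col_tileP fk.
    rewrite leqNgt; apply/negP => lt_k.
    have ne : (i', j) <> (k', j) by case=> E; move: lt_ik; rewrite -Ei -Ek E ltnn.
    (* If the lower tile started too early, its top cell would belong to both tiles. *)
    have /fdisjointP/(_ (k, nat_of_ord j)) := disj _ _ _ _ _ _ Mi Mk ne.
    rewrite !tnth_kind !kind_ordK !mem_shift_vbar /= Ei Ek eqxx !andbT lt_k (ltnW lt_ik) leqnn.
    by move=> /(_ isT); have := bar_height_gt0 e; lia.
  have := cov (x, nat_of_ord j); rewrite /= ltn_ord andbT => covx; split.
    case=> i [c [lt_i fi in_x]]; apply/covx.
    have [i' Ei Mi] := col_tileP fi; exists i', j, (kind_ord c).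
    by rewrite tnth_kind kind_ordK mem_shift_vbar /= Ei in_x eqxx.
  case/covx=> i [j' [d [Mi]]]; rewrite tnth_kind mem_shift_vbar /= => /andP[in_x /eqP Ej].
  have {Ej} Ej : j = j' by apply: val_inj.
  by exists i, (kind d); rewrite Ej col_tileE Mi decode_lift ltn_ord.
split=> [i j d i' j' d' Mi Mi' ne|x|d i|d j].
- apply/fdisjointP => x; rewrite !tnth_kind !mem_shift_vbar => /andP[in_i /eqP Ej].
  apply/negP => /andP[in_i' /eqP Ej'].
  have {Ej Ej'} Ej : j' = j by apply: val_inj; rewrite /= -Ej' -Ej.
  subst j'; have fi : col_tile M j i = Some (kind d) by rewrite col_tileE Mi decode_lift.
  have fi' : col_tile M j i' = Some (kind d') by rewrite col_tileE Mi' decode_lift.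
  have [disj _] := col j.
  case: (ltngtP i i') => [lt_i|lt_i|/val_inj eq_i]; last by case: ne; rewrite eq_i.
    by have := disj i i' _ _ fi; rewrite lt_i ltn_ord fi' => /(_ isT isT); lia.
  by have := disj i' i _ _ fi'; rewrite lt_i ltn_ord fi => /(_ isT isT); lia.
- split=> [[i [j [d [Mi]]]]|/andP[lt_x1 lt_x2]].
    rewrite tnth_kind mem_shift_vbar => /andP[in_i /eqP->]; rewrite ltn_ord andbT.
    by apply/(col j).2; exists i, (kind d); rewrite col_tileE Mi decode_lift ltn_ord.
  pose j := Ordinal lt_x2; have [i [c [lt_i fi in_x]]] := ((col j).2 x.1).2 lt_x1.
  have [i' Ei Mi] := col_tileP fi; exists i', j, (kind_ord c); split=> //.
  by rewrite tnth_kind kind_ordK mem_shift_vbar Ei in_x eqxx.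
- by rewrite -{2}(kindK d) -rowE rows /row_sum kindK (tnth_nth 0).
- by rewrite -{2}(kindK d) -colE cols /col_sum kindK (tnth_nth 0).
Qed.

Definition greedy_matrix : candidate I :=
  (\matrix_(i, j) if greedy_tile bar_height (nrows I) (ncols I) row_sum col_sum i j
                  is Some c then lift ord0 (kind_ord c) else ord0)%R.

Lemma greedy_matrix_solution :
  greedy_ok bar_height (nrows I) (ncols I) row_sum col_sum ->
  is_solution (tnth [tuple vbar p1; vbar p2]) greedy_matrix.
Proof.
case/(greedy_sound bar_height_gt0) => col rows cols.
have colE (j : 'I_(ncols I)) i : i < nrows I -> col_tile greedy_matrix j i =
    greedy_tile bar_height (nrows I) (ncols I) row_sum col_sum i j.
  move=> lt_i; rewrite (col_tileE _ _ (Ordinal lt_i)) mxE /=.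
  by case: greedy_tile => [c|]; rewrite ?decode_lift ?kind_ordK // /decode unlift_none.
apply/solutionP; split=> [j|c i|c j].
- have [disj cov] := packed_tiles (col j (ltn_ord j)); split=> [i k c /andP[lt_ik lt_k]|x].
    by rewrite !colE // ?(ltn_trans lt_ik) //; apply: disj; rewrite lt_ik.
  rewrite -cov; split=> -[i [c [lt_i fi in_x]]]; exists i, c; split=> //.
    by rewrite -colE.
  by rewrite colE.
- by rewrite -(rows i c) //; apply: eq_bigr => j _; rewrite colE.
- by rewrite -(cols j c) //; apply: eq_big_nat => i /andP[_ lt_i]; rewrite colE.
Qed.

Lemma solution_greedy_ok (M : candidate I) : is_solution (tnth [tuple vbar p1; vbar p2]) M ->
  greedy_ok bar_height (nrows I) (ncols I) row_sum col_sum.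
Proof.
case/solutionP=> col rows cols.
have pk j := tiles_packed bar_height_gt0 (col j).
have cnt c (j : 'I_(ncols I)) :
    count_mem c (word (col_tile M j) (nrows I) 0) = col_sum c j.
  by rewrite count_word // cols.
have ht (j : 'I_(ncols I)) :
    height bar_height (word (col_tile M j) (nrows I) 0) = nrows I.
  by rewrite height_word //; case: (pk j).
apply: (@greedy_complete _ bar_height_gt0 _ _ _ _ (fun j => word (col_tile M j) (nrows I) 0)).
  by move=> j lt_j; rewrite -(ht (Ordinal lt_j)) height_count !cnt.
split=> [c j|j|c y /andP[y_gt0 le_y]]; rewrite ?cnt ?ht //.
have lt_i : nrows I - y < nrows I by lia.
rewrite -(rows c (Ordinal lt_i)); apply: eq_bigr => j _ /=.
by rewrite -(starts_word bar_height_gt0 c (pk j) lt_i) subKn.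
Qed.

End Link.


(** * The program *)

Lemma arun_seq c1 c2 s : arun (ASeq c1 c2) s = arun c2 (arun c1 s).
Proof. by []. Qed.

Fixpoint silent (c : acmd) : bool :=
  match c with
  | ASet _ _ _ => true
  | ARead _ _ | AWrite _ => false
  | ASeq c1 c2 | AIf _ c1 c2 => silent c1 && silent c2
  | AFor _ _ c1 => silent c1
  end.

Lemma arun_silent c s : silent c ->
  ain (arun c s) = ain s /\ aout (arun c s) = aout s.
Proof.
elim: c s => //= [c1 IH1 c2 IH2|e c1 IH1 c2 IH2|v u c IH] s.
- by case/andP=> s1 s2; have [-> ->] := IH2 (arun c1 s) s2; apply: IH1.
- by case/andP=> s1 s2; case: ifP => _; auto.
- by move=> sc; elim: (sto s u 0) => //= N [<- <-]; apply: IH.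
Qed.

(** The step receives the counter value and the frame condition as hypotheses, so an invariant only
    has to mention the arrays that the body changes. *)
Lemma for_inv (P : nat -> astate -> Prop) v b c s :
    v \notin assigned c ->
    P 0 (aset s v 0 0) ->
    (forall k s', k < sto s b 0 -> sto s' v 0 = k ->
      (forall t, t \notin v :: assigned c -> sto s' t = sto s t) ->
      P k s' -> P k.+1 (aset (arun c s') v 0 k.+1)) ->
  P (sto s b 0) (arun (AFor v b c) s).
Proof.
move=> nv P0 Pstep /=; set f := fun k s' => _.
suff [] : [/\ P (sto s b 0) (iteri (sto s b 0) f (aset s v 0 0)),
    sto (iteri (sto s b 0) f (aset s v 0 0)) v 0 = sto s b 0 &
    forall t, t \notin v :: assigned c ->
     sto (iteri (sto s b 0) f (aset s v 0 0)) t = sto s t] by [].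
have : sto s b 0 <= sto s b 0 by [].
elim: {1 3 4 5 6 7}(sto s b 0) => [|k IH] lt_k.
  split=> //= [|t]; first by rewrite /set_at !eqxx.
  by rewrite inE negb_or => /andP[nt _]; rewrite set_at_neq.
have [Pk vk frk] := IH (ltnW lt_k); rewrite iteriS; split.
- exact: Pstep.
- by rewrite /f /= /set_at !eqxx.
- move=> t nt; have := nt; rewrite inE negb_or => /andP[ntv ntc].
  by rewrite /f /= set_at_neq // arun_frame // frk.
Qed.

Declare Scope aexpr_scope.
Delimit Scope aexpr_scope with A.
Bind Scope aexpr_scope with aexpr.
Local Notation "a + b" := (ABin OAdd a b) : aexpr_scope.
Local Notation "a - b" := (ABin OSub a b) : aexpr_scope.
Local Notation "a * b" := (ABin OMul a b) : aexpr_scope.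

Definition scal (t : nat) : aexpr := AAt t (ACst 0).

Local Notation NRows := 0 (only parsing).
Local Notation NCols := 1 (only parsing).
Local Notation Row := 2 (only parsing).
Local Notation Col := 3 (only parsing).
Local Notation Col' := 4 (only parsing).
Local Notation Ok := 5 (only parsing).
Local Notation Quota := 6 (only parsing).
Local Notation RowT := 7 (only parsing).
Local Notation RowF := 8 (only parsing).
Local Notation ColT := 9 (only parsing).
Local Notation ColF := 10 (only parsing).
Local Notation Mat := 11 (only parsing).

Section Program.

Variables (p1 p2 : nat).

Local Notation p := (bar_height p1 p2).

(** With truncated subtraction this is the absolute difference, and [posE] is the minimum with 1.
    Tests are arithmetic, and stored results are written as a small constant or a stored value minus
    something, which makes them tame. *)
Definition distE (e1 e2 : aexpr) : aexpr :=
  ((e1 - e2) + (e2 - e1))%A.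
Definition posE (e : aexpr) : aexpr :=
  (ACst 1 - (ACst 1 - e))%A.
Definition heightE (x : aexpr) : aexpr :=
  ((ACst p1 * AAt ColT x) + (ACst p2 * AAt ColF x))%A.
Definition gapE (x : aexpr) : aexpr :=
  (distE (heightE x + scal Row) (scal NRows))%A.
Definition keyE (x : aexpr) : aexpr :=
  ((AAt ColT x * scal NCols) + (scal NCols - x))%A.
Definition betterE (x y : aexpr) : aexpr :=
  ((ACst 1 - gapE x) * posE (keyE x - keyE y))%A.
Definition indexE : aexpr :=
  ((scal Row * scal NCols) + scal Col)%A.
Definition entryE : aexpr := AAt Mat indexE.
(* By truncation 0 if the column is not free, else 1 or 2 according to whether
   the quota of tiles of kind [true] is not used up. *)
Definition decisionE : aexpr :=
  (ACst 2 - ((ACst 2 * gapE (scal Col)) + posE (scal Quota)))%A.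
(* 1 exactly on the matrix entry 1 (resp. 2), given that entries are at most 2. *)
Definition isTE : aexpr :=
  (entryE * (ACst 2 - entryE))%A.
Definition isFE : aexpr :=
  (entryE - ACst 1)%A.

Definition assign (t : nat) (e : aexpr) : acmd := ASet t (ACst 0) e.

Definition read_array (t v b : nat) : acmd := AFor v b (ARead t (scal v)).

(** The flag is sticky: [1 - ((1 - Ok) + e)] is nonzero exactly when [Ok] was nonzero and [e] is
    0. *)
Definition check_heights : acmd :=
  ASeq (assign Ok (ACst 1))
    (AFor Col NCols
      (assign Ok (ACst 1 - ((ACst 1 - scal Ok)
        + distE (heightE (scal Col)) (scal NRows))))).

(** Counting the rank upwards would not be tame. Counting down from the row projection is, and the
    truncated result is positive exactly when the rank is below the projection. *)
Definition compute_rank : acmd :=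
  ASeq (assign Quota (AAt RowT (scal Row)))
    (AFor Col' NCols
      (assign Quota (scal Quota - betterE (scal Col') (scal Col)))).

(** Ranks compare the counts of all columns, so the whole row is decided before any count
    changes. *)
Definition decide_row : acmd :=
  AFor Col NCols
    (ASeq compute_rank
      (ASet Mat indexE decisionE)).

Definition consume (col row : nat) (e : aexpr) : acmd :=
  ASeq (ASet col (scal Col) (AAt col (scal Col) - e))
       (ASet row (scal Row) (AAt row (scal Row) - e)).

(** Nonzero when a tile is to be taken from an exhausted column or row count, which [consume] would
    silently truncate. *)
Definition missing (col row : nat) (e : aexpr) : aexpr :=
  (e * ((ACst 1 - AAt col (scal Col)) + (ACst 1 - AAt row (scal Row))))%A.

Definition update_body : acmd :=
  ASeq (assign Ok (ACst 1 - ((ACst 1 - scal Ok)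
             + (missing ColT RowT isTE + missing ColF RowF isFE))))
    (ASeq (consume ColT RowT isTE) (consume ColF RowF isFE)).

Definition update_row : acmd := AFor Col NCols update_body.

Definition check_row : acmd :=
  assign Ok (ACst 1 - ((ACst 1 - scal Ok)
    + (AAt RowT (scal Row) + AAt RowF (scal Row)))).

Definition process_row : acmd :=
  ASeq decide_row (ASeq update_row check_row).

Definition write_matrix : acmd :=
  AFor Row NRows (AFor Col NCols (AWrite entryE)).

Definition main : acmd :=
  ASeq (read_array RowT Row NRows)
  (ASeq (read_array RowF Row NRows)
  (ASeq (read_array ColT Col NCols)
  (ASeq (read_array ColF Col NCols)
  (ASeq check_heights
  (ASeq (AFor Row NRows process_row)
    (AIf (scal Ok) (ASeq (AWrite (ACst 1)) write_matrix)
      (AWrite (ACst 0)))))))).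

Lemma wf_main : wf main.
Proof. by []. Qed.

(** * Specifications of the subprograms *)

Definition cols (s : astate) (c : bool) : nat -> nat := sto s (if c then ColT else ColF).
Definition rows (s : astate) (c : bool) : nat -> nat := sto s (if c then RowT else RowF).

Lemma read_arrayP t v b s l w : t != v -> ain s = l ++ w -> size l = sto s b 0 ->
  ain (arun (read_array t v b) s) = w /\
  forall k, k < sto s b 0 -> sto (arun (read_array t v b) s) t k = nth 0 l k.
Proof.
move=> ne_tv in_s sz_l.
suff [-> tP] : ain (arun (read_array t v b) s) = drop (sto s b 0) l ++ w /\
    forall k, k < sto s b 0 -> sto (arun (read_array t v b) s) t k = nth 0 l k.
  by split; first by rewrite -sz_l drop_size.
apply: (for_inv (P := fun N s' => ain s' = drop N l ++ w /\
    forall k, k < N -> sto s' t k = nth 0 l k)) => [||k s' lt_k vk fr [in_s' tk]] /=.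
- by rewrite inE eq_sym.
- by rewrite drop0.
- rewrite in_s' vk (drop_nth 0) ?sz_l //=; split=> // x.
  rewrite ltnS /set_at (negPf ne_tv) eqxx /=; case: eqP => [->|ne_x] // le_x.
  by apply: tk; rewrite ltn_neqAle le_x andbT; apply/eqP.
Qed.

Lemma check_heightsP s :
  0 < sto (arun check_heights s) Ok 0 <-> forall j, j < sto s NCols 0 ->
    col_height p (cols s) j = sto s NRows 0.
Proof.
pose P N s' := 0 < sto s' Ok 0 <->
    forall j, j < N -> col_height p (cols s) j = sto s NRows 0.
rewrite /check_heights arun_seq; set s1 := arun (assign _ _) s.
suff : P (sto s1 NCols 0) (arun (AFor Col NCols (assign Ok (ACst 1 - ((ACst 1 - scal Ok)
        + distE (heightE (scal Col)) (scal NRows))))) s1) by [].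
apply: for_inv => [||k s' lt_k vk fr okP] //.
rewrite /P /=.
rewrite /set_at /= !vk (fr 9) // (fr 10) // (fr 0) //.
have -> : p1 * sto s ColT k + p2 * sto s ColF k = col_height p (cols s) k by [].
rewrite -[sto s1 NRows 0]/(sto s NRows 0).
split=> [ok_gt0 j|col_ok].
  rewrite ltnS leq_eqVlt => /predU1P[->|lt_j]; first by lia.
  by apply: okP.1 => //; lia.
have ok_gt0 : 0 < sto s' Ok 0 by apply: okP.2 => j /ltnW; apply: col_ok.
by rewrite col_ok //; lia.
Qed.


(** The program compares height plus row with [m], whereas [free] compares the height with the
    truncated [m - i]; the hypothesis makes the two agree. *)
Lemma betterEE s x y : sto s Row 0 <= sto s NRows 0 ->
  aeval (sto s) (betterE x y) =
    free p (sto s NRows 0 - sto s Row 0) (cols s) (aeval (sto s) x) &&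
    (key (sto s NCols 0) (cols s) (aeval (sto s) y) <
     key (sto s NCols 0) (cols s) (aeval (sto s) x)).
Proof.
move=> le_row; rewrite /free /col_height /key /cols /=.
move: (aeval _ x) (aeval _ y) => a b; lia.
Qed.

Lemma asetE t e1 e2 s x : sto (arun (ASet t e1 e2) s) t x =
  if x == aeval (sto s) e1 then aeval (sto s) e2 else sto s t x.
Proof. by rewrite /= /set_at eqxx. Qed.

(** The value of [e] must not depend on the two modified arrays, because it is evaluated again after
    the first store. *)
Lemma consumeP col row e s a : col != row ->
    Col \notin [:: col; row] -> Row \notin [:: col; row] ->
    (forall s', (forall t, t \notin [:: col; row] -> sto s' t = sto s t) ->
      aeval (sto s') e = a) ->
  (forall x, sto (arun (consume col row e) s) col x =
    sto s col x - (x == sto s Col 0) * a) /\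
  (forall x, sto (arun (consume col row e) s) row x =
    sto s row x - (x == sto s Row 0) * a).
Proof.
move=> ne_cr nC nR he; rewrite /consume arun_seq; set s1 := arun _ s.
have fr t : t != col -> sto s1 t = sto s t by move=> nt; apply: arun_frame; rewrite inE.
have e1 : aeval (sto s1) e = a.
  by apply: he => t; rewrite !inE negb_or => /andP[nt _]; apply: fr.
have e0 : aeval (sto s) e = a by apply: he.
split=> x.
  rewrite arun_frame ?inE // asetE.
  rewrite -[aeval _ (scal Col)]/(sto s Col 0); case: eqP => [->|_] /=.
    by rewrite mul1n e0.
  by rewrite subn0.
have nr : row != col by rewrite eq_sym.
have nR' : Row != col by move: nR; rewrite !inE negb_or => /andP[].
rewrite asetE -[aeval _ (scal Row)]/(sto s1 Row 0) (fr Row nR') (fr row nr).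
case: eqP => [->|_]; last by rewrite mul0n subn0.
transitivity (sto s1 row (sto s1 Row 0) - aeval (sto s1) e); first by [].
by rewrite mul1n e1 (fr row nr) (fr Row nR').
Qed.

Lemma cols_frame s s' : sto s' ColT = sto s ColT -> sto s' ColF = sto s ColF ->
  cols s' = cols s.
Proof. by move=> eT eF; apply: functional_extensionality => -[]. Qed.

Lemma compute_rankP s : sto s Row 0 <= sto s NRows 0 ->
  sto (arun compute_rank s) Quota 0 =
    rows s true (sto s Row 0)
    - rank p (sto s NCols 0) (sto s NRows 0 - sto s Row 0) (cols s) (sto s Col 0).
Proof.
move=> le_row; rewrite /compute_rank arun_seq; set s1 := arun (assign _ _) s.
pose P N s' := sto s' Quota 0 = rows s true (sto s Row 0) - \sum_(k < N)
  (free p (sto s NRows 0 - sto s Row 0) (cols s) k &&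
   (key (sto s NCols 0) (cols s) (sto s Col 0) < key (sto s NCols 0) (cols s) k)).
suff : P (sto s1 NCols 0) (arun (AFor Col' NCols
      (assign Quota (scal Quota - betterE (scal Col') (scal Col)))) s1) by [].
apply: for_inv => [||k s' lt_k vk fr qk] //.
  by rewrite /P big_ord0 subn0.
transitivity (subn (sto s' Quota 0) (aeval (sto s') (betterE (scal Col') (scal Col)))).
  by [].
have ec : cols s' = cols s by apply: cols_frame; apply: fr.
rewrite betterEE; last by rewrite (fr Row) // (fr NRows).
rewrite ec (fr NRows) // (fr Row) // (fr NCols) // qk -subnDA big_ord_recr /=.
by rewrite vk (fr Col).
Qed.

Section Row_step.

Variable s : astate.
Hypothesis lt_row : sto s Row 0 < sto s NRows 0.

Local Notation m := (sto s NRows 0).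
Local Notation n := (sto s NCols 0).
Local Notation i := (sto s Row 0).

Definition chosen (c : bool) (j : nat) : bool :=
  pick p n (m - i) (rows s true i) (cols s) c j.

Definition entry (j : nat) : nat := chosen true j + 2 * chosen false j.

Lemma decide_rowP :
  (forall j, j < n -> sto (arun decide_row s) Mat (i * n + j) = entry j) /\
  (forall x, x < i * n -> sto (arun decide_row s) Mat x = sto s Mat x).
Proof.
pose P N s' := (forall j, j < N -> sto s' Mat (i * n + j) = entry j) /\
  (forall x, x < i * n -> sto s' Mat x = sto s Mat x).
suff : P n (arun decide_row s) by [].
apply: for_inv => [||k s' lt_k vk fr [entk old]] //.
rewrite arun_seq; set s2 := arun compute_rank s'.
have fr2 t : t \notin [:: Quota; Col'; Quota] -> sto s2 t = sto s' t.
  by move=> nt; apply: arun_frame.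
have q2 : sto s2 Quota 0 = rows s true i - rank p n (m - i) (cols s) k.
  have ec : cols s' = cols s by apply: cols_frame; apply: fr.
  rewrite compute_rankP; last by rewrite (fr Row) // (fr NRows) // ltnW.
  by rewrite ec /rows (fr NRows) // (fr Row) // (fr NCols) // (fr RowT) // vk.
have val : aeval (sto s2) decisionE = entry k.
  rewrite /= q2 !fr2 // vk !fr // /entry /chosen /pick /free /col_height /=.
  move: (rank _ _ _ _ _) (rows _ _ _) => a b.
  rewrite /cols; lia.
have idx : aeval (sto s2) indexE = i * n + k by rewrite /= !fr2 // vk !fr.
have stp y : sto (aset (arun (ASet Mat indexE decisionE) s2) Col 0 k.+1) Mat y =
    if y == i * n + k then entry k else sto s' Mat y.
  rewrite -val -idx -fr2 //=; rewrite /set_at; by case: ifP.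
split=> [j lt_j|x lt_x]; rewrite stp; case: eqP => [E|ne_j].
- by rewrite (addnI E).
- by apply: entk; lia.
- by lia.
- exact: old.
Qed.

End Row_step.

Section Update.

Variables (s : astate) (pk : bool -> nat -> bool).

Local Notation n := (sto s NCols 0).
Local Notation i := (sto s Row 0).

Hypothesis pk_excl : forall j, ~~ (pk true j && pk false j).
Hypothesis entries : forall j, j < n ->
  sto s Mat (i * n + j) = pk true j + 2 * pk false j.

Lemma update_bodyP (s' : astate) k : k < n -> sto s' Col 0 = k ->
    sto s' NCols 0 = n -> sto s' Row 0 = i -> sto s' Mat = sto s Mat ->
  let s1 := arun update_body s' in
  [/\ forall c x, cols s1 c x = cols s' c x - (x == k) * pk c k,
      forall c x, rows s1 c x = rows s' c x - (x == i) * pk c k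
    & 0 < sto s1 Ok 0 <-> 0 < sto s' Ok 0 /\
        forall c, pk c k -> 0 < cols s' c k /\ 0 < rows s' c i].
Proof.
move=> lt_k vk vn vi vM.
have eT : (pk true k + 2 * pk false k) * (2 - (pk true k + 2 * pk false k)) = pk true k.
  by have := pk_excl k; case: (pk true k) (pk false k) => [] [].
have eF : pk true k + 2 * pk false k - 1 = pk false k.
  by have := pk_excl k; case: (pk true k) (pk false k) => [] [].
have vals s0 : sto s0 NCols = sto s' NCols -> sto s0 Row = sto s' Row ->
    sto s0 Col = sto s' Col -> sto s0 Mat = sto s' Mat ->
    aeval (sto s0) isTE = pk true k /\ aeval (sto s0) isFE = pk false k.
  by move=> /= -> -> -> ->; rewrite vk vn vi vM entries // eT eF.
rewrite /update_body !arun_seq; set s1 := arun (assign _ _) s'.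
have fr1 t : t != Ok -> sto s1 t = sto s' t by move=> nt; apply: arun_frame; rewrite inE.
have [cT rT] : _ /\ _ := @consumeP ColT RowT isTE s1 (pk true k) isT isT isT (fun s0 fr0 =>
  (vals s0 (fr0 NCols isT) (fr0 Row isT) (fr0 Col isT) (fr0 Mat isT)).1).
set s2 := arun _ s1 in cT rT *.
have fr2 t : t \notin assigned (consume ColT RowT isTE) -> sto s2 t = sto s1 t.
  exact: arun_frame.
have [cF rF] : _ /\ _ := @consumeP ColF RowF isFE s2 (pk false k) isT isT isT (fun s0 fr0 =>
  (vals s0 (fr0 NCols isT) (fr0 Row isT) (fr0 Col isT) (fr0 Mat isT)).2).
set s3 := arun _ s2 in cF rF *.
have fr3 t : t \notin assigned (consume ColF RowF isFE) -> sto s3 t = sto s2 t.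
  exact: arun_frame.
have vT := (vals s' erefl erefl erefl erefl).1.
have vF := (vals s' erefl erefl erefl erefl).2.
have ok1 : sto s1 Ok 0 = 1 - (1 - sto s' Ok 0 +
    (pk true k * (1 - sto s' ColT k + (1 - sto s' RowT i)) +
     pk false k * (1 - sto s' ColF k + (1 - sto s' RowF i)))).
  by rewrite asetE -vT -vF -vk -vi.
split.
- case=> x; rewrite /cols.
    by rewrite (fr3 ColT) // cT (fr1 Col) // vk (fr1 ColT).
  by rewrite cF (fr2 Col) // (fr1 Col) // vk (fr2 ColF) // (fr1 ColF).
- case=> x; rewrite /rows.
    by rewrite (fr3 RowT) // rT (fr1 Row) // vi (fr1 RowT).
  by rewrite rF (fr2 Row) // (fr1 Row) // vi (fr2 RowF) // (fr1 RowF).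
rewrite (fr3 Ok) // (fr2 Ok) // ok1 {ok1 vT vF rF cF rT cT fr2 fr3 fr1 vals}.
split=> [ok|[ok pos]].
  split; first by lia.
  by case=> pk1; rewrite /cols /rows; move: ok; rewrite pk1 !mul1n; clear -pk1; lia.
move: (pos true) (pos false); rewrite /cols /rows.
by case: (pk true k) => [/(_ isT)[? ?]|_]; case: (pk false k) => [/(_ isT)[? ?]|_];
  rewrite ?mul1n ?mul0n; lia.
Qed.

(** Every pick finds a positive row count exactly when the total number of picks is at most the row
    projection. [check_row], requiring nothing to be left over, turns this into an equality. *)
Lemma update_rowP : let s' := arun update_row s in
  [/\ forall c j, j < n -> cols s' c j = cols s c j - pk c j,
      forall c x, rows s' c x = rows s c x - (x == i) * \sum_(j < n) pk c j
    & 0 < sto s' Ok 0 <-> [/\ 0 < sto s Ok 0,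
        forall c j, j < n -> pk c j -> 0 < cols s c j
      & forall c, \sum_(j < n) pk c j <= rows s c i]].
Proof.
pose P N s' := [/\ forall c x, cols s' c x = cols s c x - (x < N) * pk c x,
      forall c x, rows s' c x = rows s c x - (x == i) * \sum_(j < N) pk c j
    & 0 < sto s' Ok 0 <-> [/\ 0 < sto s Ok 0,
        forall c j, j < N -> pk c j -> 0 < cols s c j
      & forall c, \sum_(j < N) pk c j <= rows s c i]].
suff : P n (arun update_row s).
  by case=> cP rP okP; split=> // c j lt_j; rewrite cP lt_j mul1n.
apply: for_inv => [||k s' lt_k vk fr [cP rP okP]] //.
  split=> [c x|c x|]; [by rewrite ltn0 subn0; case: c | by rewrite big_ord0 muln0 subn0; case: c |].
  split=> [ok|[]//]; split=> // c; by rewrite big_ord0.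
have [c1 r1 o1P] := @update_bodyP s' k lt_k vk
   (congr1 (fun g => g 0) (fr NCols isT)) (congr1 (fun g => g 0) (fr Row isT)) (fr Mat isT).
split=> [c x|c x|].
- transitivity (cols (arun update_body s') c x); first by case: c.
  rewrite c1 cP ltnS; case: (ltngtP x k) => [||->]; rewrite ?mul1n ?mul0n ?subn0 //.
- transitivity (rows (arun update_body s') c x); first by case: c.
  rewrite r1 rP big_ord_recr /=; case: (x == i); rewrite ?mul1n ?mul0n ?subn0 //.
  by rewrite subnDA.
rewrite [sto _ Ok 0]/(sto (arun update_body s') Ok 0) o1P okP; split.
  case=> -[ok pos le_r] posk; split=> // [c j|c].
    rewrite ltnS leq_eqVlt => /predU1P[->|]; last exact: pos.
    by case/posk; rewrite cP ltnn subn0.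
  have := le_r c; have := posk c; rewrite rP eqxx mul1n big_ord_recr /=.
  by case: (pk c k) => [/(_ isT)[_]|_]; lia.
case=> ok pos le_r; split.
  split=> // [c j lt_j|c]; first by apply: pos; apply: ltnW.
  by have := le_r c; rewrite big_ord_recr /=; lia.
move=> c pkk; rewrite cP ltnn subn0 rP eqxx mul1n; split; first exact: pos.
by have := le_r c; rewrite big_ord_recr /= pkk; lia.
Qed.

End Update.

Lemma process_rowP s : sto s Row 0 < sto s NRows 0 ->
  let s' := arun process_row s in
  let n := sto s NCols 0 in let i := sto s Row 0 in
  [/\ forall c j, j < n -> cols s' c j = cols s c j - chosen s c j,
      forall c x, i < x -> rows s' c x = rows s c x,
      0 < sto s' Ok 0 <-> [/\ 0 < sto s Ok 0,
        forall c j, j < n -> chosen s c j -> 0 < cols s c j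
      & forall c, \sum_(j < n) chosen s c j = rows s c i]
    & forall x, x < i.+1 * n -> sto s' Mat x =
        if x < i * n then sto s Mat x else entry s (x - i * n)].
Proof.
move=> lt_row; rewrite /process_row !arun_seq.
set s1 := arun decide_row s; set s2 := arun update_row s1; set s3 := arun check_row s2.
set n := sto s NCols 0; set i := sto s Row 0.
have [new old] := decide_rowP lt_row; rewrite -/s1 in new old.
have fr1 t : t \notin assigned decide_row -> sto s1 t = sto s t by apply: arun_frame.
have fr2 t : t \notin assigned update_row -> sto s2 t = sto s1 t by apply: arun_frame.
have fr3 t : t != Ok -> sto s3 t = sto s2 t by move=> nt; apply: arun_frame; rewrite inE.
have excl j : ~~ (chosen s true j && chosen s false j).
  by rewrite /chosen /pick; case: free => //=; case: (_ < _).
have n1 : sto s1 NCols 0 = n by rewrite fr1.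
have i1 : sto s1 Row 0 = i by rewrite fr1.
have ent j : j < sto s1 NCols 0 ->
    sto s1 Mat (sto s1 Row 0 * sto s1 NCols 0 + j) = chosen s true j + 2 * chosen s false j.
  by rewrite n1 i1; apply: new.
have [cP rP okP] := update_rowP excl ent; rewrite -/s2 n1 i1 in cP rP okP.
have c1 : cols s1 = cols s by apply: cols_frame; apply: fr1.
have r1 c : rows s1 c = rows s c by case: c; apply: fr1.
have c3 : cols s3 = cols s2 by apply: cols_frame; apply: fr3.
have r3 c : rows s3 c = rows s2 c by case: c; apply: fr3.
split=> [c j lt_j|c x lt_x||x lt_x].
- by rewrite c3 cP // c1.
- by rewrite r3 rP gtn_eqF // mul0n subn0 r1.
- rewrite asetE /= (fr2 Row) // i1.
  rewrite -[sto s2 RowT i]/(rows s2 true i) -[sto s2 RowF i]/(rows s2 false i).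
  have -> : (0 < 1 - (1 - sto s2 Ok 0 + (rows s2 true i + rows s2 false i))) =
      [&& 0 < sto s2 Ok 0, rows s2 true i == 0 & rows s2 false i == 0] by lia.
  have rE c : rows s2 c i = rows s c i - \sum_(j < n) chosen s c j.
    by rewrite rP eqxx mul1n r1.
  have ok_s : sto s1 Ok 0 = sto s Ok 0 by rewrite fr1.
  rewrite ok_s in okP; split.
    case/and3P=> /okP[ok pos le_r] /eqP rT /eqP rF; split=> // [c j|c].
      by rewrite -c1; apply: pos.
    apply/eqP; rewrite eqn_leq -r1 le_r r1 -subn_eq0 -rE.
    by case: c; rewrite ?rT ?rF.
  case=> ok pos eq_r; apply/and3P; split; last by rewrite rE eq_r subnn.
    by apply/okP; split=> // [c j|c]; rewrite ?c1 ?r1 ?eq_r //; apply: pos.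
  by rewrite rE eq_r subnn.
- rewrite (fr3 Mat) // (fr2 Mat) //; case: ltnP => [|le_x]; first exact: old.
  by rewrite -new ?subnKC //; move: lt_x; rewrite mulSn -/n; lia.
Qed.

Lemma pick_congr n z r C C' c j : j < n ->
    (forall c j, j < n -> C c j = C' c j) ->
  pick p n z r C c j = pick p n z r C' c j.
Proof.
move=> lt_j eqC; have eqF k : k < n -> free p z C k = free p z C' k.
  by move=> lt_k; rewrite /free /col_height !eqC.
rewrite /pick eqF //; congr (_ && ((_ < _) == _)).
by apply: eq_bigr => k _; rewrite eqF // /key !eqC.
Qed.

Section Main_loop.

Variables (s : astate) (r q : bool -> nat -> nat).

Local Notation m := (sto s NRows 0).
Local Notation n := (sto s NCols 0).

Hypothesis r_init : forall c i, i < m -> rows s c i = r c i.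
Hypothesis q_init : forall c j, j < n -> cols s c j = q c j.

Definition tile_code (o : option bool) : nat :=
  if o is Some c then if c then 1 else 2 else 0.

(** The matrix clause holds even after a failure: program and [remaining] truncate in the same way,
    so their runs stay in step. *)
Lemma main_loopP : let s' := arun (AFor Row NRows process_row) s in
  (0 < sto s' Ok 0 <->
     0 < sto s Ok 0 /\ (forall i, i < m -> greedy_row_ok p m n r q i)) /\
  (forall i j, i < m -> j < n ->
        sto s' Mat (i * n + j) = tile_code (greedy_tile p m n r q i j)).
Proof.
pose P N s' := [/\ forall c j, j < n -> cols s' c j = remaining p m n r q N c j,
      forall c i, N <= i < m -> rows s' c i = r c i,
      0 < sto s' Ok 0 <->
        0 < sto s Ok 0 /\ (forall i, i < N -> greedy_row_ok p m n r q i)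
    & forall i j, i < N -> j < n ->
        sto s' Mat (i * n + j) = tile_code (greedy_tile p m n r q i j)].
suff : P m (arun (AFor Row NRows process_row) s) by case.
apply: for_inv => [||k s' lt_k vk fr [cP rP okP mP]] //.
  split=> // [c j lt_j|c i lt_i|].
  - by rewrite /= -q_init //; case: c.
  - by rewrite -r_init //; case: c.
  - by split=> [|[]].
have n1 : sto s' NCols 0 = n by rewrite fr.
have m1 : sto s' NRows 0 = m by rewrite fr.
have chE c j : j < n -> chosen s' c j = picked p m n r q k c j.
  move=> lt_j; rewrite /chosen vk n1 m1 rP ?leqnn //; exact: pick_congr.
have [|c1 r1 o1P m1P] := @process_rowP s'; first by rewrite vk m1.
rewrite vk n1 in c1 r1 o1P m1P.
split=> [c j lt_j|c i /andP[lt_ki lt_i]||i j lt_i lt_j].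
- transitivity (cols (arun process_row s') c j); first by case: c.
  by rewrite c1 // cP // chE.
- transitivity (rows (arun process_row s') c i); first by case: c.
  by rewrite r1 // rP // ltnW.
- have rowE : greedy_row_ok p m n r q k <->
      (forall c j, j < n -> chosen s' c j -> 0 < cols s' c j) /\
      (forall c, \sum_(j < n) chosen s' c j = rows s' c k).
    split=> -[pos sums]; split=> [c j lt_j|c].
    + by rewrite chE // cP //; apply: pos.
    + by rewrite rP ?leqnn // -sums; apply: eq_bigr => j _; rewrite chE.
    + by rewrite -chE // -cP //; apply: pos.
    + by rewrite -rP ?leqnn // -sums; apply: eq_bigr => j _; rewrite chE.
  apply: iff_trans o1P _; split=> [[/okP[ok prev] pos sums]|[ok rows_ok]].
    split=> // i; rewrite ltnS leq_eqVlt => /predU1P[->|]; last exact: prev.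
    by apply/rowE.
  have [] := rowE.1 (rows_ok k (ltnSn k)).
  by split=> //; apply/okP; split=> // i /ltnW; apply: rows_ok.
- transitivity (sto (arun process_row s') Mat (i * n + j)); first by [].
  have lt_idx a b : a < b -> a * n + j < b * n.
    by move=> lt_ab; apply: (@leq_trans (a.+1 * n));
      rewrite ?leq_mul2r ?lt_ab ?orbT // mulSn addnC ltn_add2r.
  rewrite m1P; last exact: lt_idx.
  move: lt_i; rewrite ltnS leq_eqVlt => /predU1P[->|lt_i].
    rewrite ltnNge leq_addr /= addKn /entry !chE // /greedy_tile /picked /pick.
    by case: free => //=; case: (_ < _).
  by rewrite lt_idx //; apply: mP.
Qed.

End Main_loop.

Lemma write_rowP s :
  aout (arun (AFor Col NCols (AWrite entryE)) s) = aout s ++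
    [seq sto s Mat (sto s Row 0 * sto s NCols 0 + j) | j <- iota 0 (sto s NCols 0)].
Proof.
pose P N s' := aout s' = aout s ++
    [seq sto s Mat (sto s Row 0 * sto s NCols 0 + j) | j <- iota 0 N].
suff : P (sto s NCols 0) (arun (AFor Col NCols (AWrite entryE)) s) by [].
apply: for_inv => [||k s' lt_k vk fr out] //; first by rewrite /P cats0.
rewrite /P -[k.+1]addn1 iotaD map_cat catA -out /= vk cats1.
by rewrite (fr Mat) // (fr Row) // (fr NCols).
Qed.

Lemma write_matrixP s :
  aout (arun write_matrix s) = aout s ++
    [seq sto s Mat (i * sto s NCols 0 + j) | i <- iota 0 (sto s NRows 0),
                                             j <- iota 0 (sto s NCols 0)].
Proof.
pose P N s' := aout s' = aout s ++
    [seq sto s Mat (i * sto s NCols 0 + j) | i <- iota 0 N, j <- iota 0 (sto s NCols 0)].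
suff : P (sto s NRows 0) (arun write_matrix s) by [].
apply: for_inv => [||k s' lt_k vk fr out] //; first by rewrite /P cats0.
rewrite /P -[k.+1]addn1 iotaD map_cat flatten_cat catA -out.
transitivity (aout (arun (AFor Col NCols (AWrite entryE)) s')); first by [].
rewrite write_rowP vk.
by rewrite /= cats0 (fr Mat) // (fr NCols).
Qed.

End Program.

(** * Output and running time of the whole program *)

Section Final.

Variables (p1 p2 : nat).

Local Notation p := (bar_height p1 p2).

Lemma mainP (I : instance 2) s :
    sto s NRows 0 = nrows I -> sto s NCols 0 = ncols I ->
    ain s = rproj I ord0 ++ rproj I ord_max ++ sproj I ord0 ++ sproj I ord_max ->
    aout s = [::] ->
  let out := aout (arun (main p1 p2) s) in
  (greedy_ok p (nrows I) (ncols I) (row_sum I) (col_sum I) /\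
   out = 1 :: [seq tile_code (greedy_tile p (nrows I) (ncols I) (row_sum I) (col_sum I) i j)
              | i <- iota 0 (nrows I), j <- iota 0 (ncols I)]) \/
  (~ greedy_ok p (nrows I) (ncols I) (row_sum I) (col_sum I) /\ out = [:: 0]).
Proof.
move=> m0 n0 in0 out0; rewrite /main !arun_seq.
set s1 := arun (read_array RowT _ _) s.
have [in1 rT] := read_arrayP (t := RowT) (v := Row) (b := NRows) isT in0
  (etrans (size_tuple _) (esym m0)).
rewrite -/s1 in in1 rT.
have fr1 t : t \notin assigned (read_array RowT Row NRows) -> sto s1 t = sto s t by apply: arun_frame.
have m1 : sto s1 NRows 0 = nrows I by rewrite fr1.
have n1 : sto s1 NCols 0 = ncols I by rewrite fr1.
set s2 := arun (read_array RowF _ _) s1.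
have [in2 rF] := read_arrayP (t := RowF) (v := Row) (b := NRows) isT in1
  (etrans (size_tuple _) (esym m1)).
rewrite -/s2 in in2 rF.
have fr2 t : t \notin assigned (read_array RowF Row NRows) -> sto s2 t = sto s1 t by apply: arun_frame.
have m2 : sto s2 NRows 0 = nrows I by rewrite fr2.
have n2 : sto s2 NCols 0 = ncols I by rewrite fr2.
set s3 := arun (read_array ColT _ _) s2.
have [in3 cT] := read_arrayP (t := ColT) (v := Col) (b := NCols) isT in2
  (etrans (size_tuple _) (esym n2)).
rewrite -/s3 in in3 cT.
have fr3 t : t \notin assigned (read_array ColT Col NCols) -> sto s3 t = sto s2 t by apply: arun_frame.
have m3 : sto s3 NRows 0 = nrows I by rewrite fr3.
have n3 : sto s3 NCols 0 = ncols I by rewrite fr3.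
set s4 := arun (read_array ColF _ _) s3.
rewrite -[X in ain s3 = X]cats0 in in3.
have [_ cF] := read_arrayP (t := ColF) (v := Col) (b := NCols) isT in3
  (etrans (size_tuple _) (esym n3)).
rewrite -/s4 in cF.
have fr4 t : t \notin assigned (read_array ColF Col NCols) -> sto s4 t = sto s3 t by apply: arun_frame.
have m4 : sto s4 NRows 0 = nrows I by rewrite fr4.
have n4 : sto s4 NCols 0 = ncols I by rewrite fr4.
set s5 := arun (check_heights p1 p2) s4.
have fr5 t : t \notin assigned (check_heights p1 p2) -> sto s5 t = sto s4 t by apply: arun_frame.
have m5 : sto s5 NRows 0 = nrows I by rewrite fr5.
have n5 : sto s5 NCols 0 = ncols I by rewrite fr5.
have rowsE c i : i < sto s5 NRows 0 -> rows s5 c i = row_sum I c i.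
  rewrite m5; case: c => lt_i; rewrite /rows fr5 // fr4 // fr3 //.
    by rewrite fr2 // rT ?m0.
  by rewrite rF ?m1.
have cols4 c j : j < ncols I -> cols s4 c j = col_sum I c j.
  case: c => lt_j; rewrite /cols.
    by rewrite fr4 // cT ?n2.
  by rewrite cF ?n3.
have colsE c j : j < sto s5 NCols 0 -> cols s5 c j = col_sum I c j.
  by rewrite n5 => lt_j; rewrite (cols_frame (s := s4)) ?cols4 //; apply: fr5.
have ok5P := check_heightsP p1 p2 s4; rewrite -/s5 in ok5P.
set s6 := arun (AFor _ _ _) s5.
have [ok6P mP] := main_loopP p1 p2 rowsE colsE; rewrite -/s6 m5 n5 in ok6P mP.
have out6 : aout s6 = [::].
  pose silent_tail := ASeq (check_heights p1 p2) (AFor Row NRows (process_row p1 p2)).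
  have [_ ->] := @arun_silent silent_tail s4 isT.
  rewrite -out0 /s4 /s3 /s2 /s1.
  have aout_read t v b s' : aout (arun (read_array t v b) s') = aout s'.
    by rewrite /=; elim: (sto s' b 0).
  by rewrite !aout_read.
have okE : 0 < sto s6 Ok 0 <-> greedy_ok p (nrows I) (ncols I) (row_sum I) (col_sum I).
  apply: iff_trans ok6P _; rewrite /greedy_ok; rewrite m4 n4 in ok5P.
  have hE j : j < ncols I -> col_height p (cols s4) j = col_height p (col_sum I) j.
    by move=> lt_j; rewrite /col_height !cols4.
  split=> [[/ok5P hs rows_ok]|[hs rows_ok]]; split=> //.
    by move=> j lt_j; rewrite -hE // hs.
  by apply/ok5P => j lt_j; rewrite hE // hs.
rewrite [arun (AIf _ _ _) s6]/= -[sto s6 _ _]/(sto s6 Ok 0) -lt0n.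
case: ifP => ok; [left | right]; split.
- exact/okE.
- transitivity (aout (arun write_matrix (arun (AWrite (ACst 1)) s6))); first by [].
  rewrite write_matrixP /= out6 /=; congr (_ :: _).
  have fr6 t : t \notin assigned (AFor Row NRows (process_row p1 p2)) -> sto s6 t = sto s5 t.
    exact: arun_frame.
  rewrite (fr6 NRows) // (fr6 NCols) // m5 n5.
  apply/eq_in_allpairs_dep => i; rewrite mem_iota /= => lt_i j; rewrite mem_iota /= => lt_j.
  exact: mP.
- by move/okE; rewrite ok.
- by rewrite /= out6.
Qed.

Lemma encode_greedy_matrix (I : instance 2) :
  encode_matrix (greedy_matrix p1 p2 I) =
  [seq tile_code (greedy_tile p (nrows I) (ncols I) (row_sum I) (col_sum I) i j)
  | i <- iota 0 (nrows I), j <- iota 0 (ncols I)].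
Proof.
rewrite -!val_enum_ord allpairs_mapl allpairs_mapr.
apply: eq_allpairs => i j; rewrite mxE.
by case: greedy_tile => [[]|].
Qed.

Lemma enum_ord2 : enum 'I_2 = [:: ord0; ord_max].
Proof. by apply: (inj_map val_inj); rewrite val_enum_ord. Qed.

Lemma size_le_word_size w : size w <= word_size w.
Proof. by elim: w => //= x w IH; rewrite /word_size big_cons -add1n leq_add. Qed.

Lemma bits_sum_le w : bits (\sum_(x <- w) x) <= (word_size w).+1.
Proof.
elim: w => [|x w IH]; first by rewrite /word_size !big_nil.
rewrite /word_size !big_cons -addnS; apply: leq_trans (bitsD _ _) _.
by rewrite leq_add2l.
Qed.

Lemma leq_sum_mem w x : x \in w -> x <= \sum_(y <- w) y.
Proof. by move=> xw; rewrite (big_rem x xw) /= leq_addr. Qed.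

(** The dimensions are read outside [main], directly into addresses 0 and 1, which are entry 0 of
    arrays 0 and 1: well-formed commands must not assign these arrays. *)
Definition program : cmd :=
  Seq (Read (Cst 0)) (Seq (Read (Cst 1)) (ccomp (main p1 p2))).

(** The size hypothesis is what makes loops up to [m] and [n] affordable: the projections are
    written out in full, so the input length dominates the dimensions themselves and not just their
    logarithms. *)
Lemma program_poly_time : exists a b, forall m n w,
  (m + n).+2 <= size [:: m, n & w] -> exists2 t,
    exec program (init_state [:: m, n & w]) t
      (flat_state (arun (main p1 p2)
        (AState (set_at (set_at (fun _ _ => 0) 0 0 m) 1 0 n) w [::])))
    & t <= a * word_size [:: m, n & w] ^ b + a.
Proof.
have [K EK] : exists K, K = costK (main p1 p2) by eexists.
have [D ED] : exists D, D = loop_depth (main p1 p2) by eexists.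
(* The factor 4 comes from [bits b <= W + 3 <= 4 * W]; the two initial reads cost at most [W + 4],
   absorbed by the 6. *)
exists (4 * K + 6), D.+1 => m n w sz.
set x := [:: m, n & w] in sz *; set W := word_size x.
(* The sum dominates every input number and its bit length is linear in [W]; the 2 accounts for the
   tame constants. *)
pose b := 2 + \sum_(y <- x) y; pose N := maxn m n.
set s := AState _ _ _.
have xb y : y \in x -> y <= b by move/leq_sum_mem/leq_trans; apply; rewrite leq_addl.
have leNb : N <= b by rewrite geq_max !xb // !inE eqxx ?orbT.
have bd : bounded N b s.
  split=> [t k|||] /=.
  - rewrite /set_at; case: ifP => _; first by rewrite xb // !inE eqxx ?orbT.
    by case: ifP => _ //; rewrite xb // !inE eqxx.
  - by apply/allP => y yw; rewrite xb // !inE yw !orbT.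
  - by rewrite leq_maxl.
  - by rewrite leq_maxr.
have [[T exT leT] _] := ccomp_sound (leq_addr _ _ : 2 <= b) leNb (wf_main p1 p2) bd.
exists ((bits 0 + bits 0 + bits m) + ((bits 1 + bits 1 + bits n) + T)).
  apply: ExSeq (ExRead (Cst 0) _ _ _) _; apply: ExSeq (ExRead (Cst 1) _ _ _) _.
  move: exT; rewrite [flat_state s](_ : _ = State (upd (upd (fun=> 0) 0 m) 1 n) w [::]) //.
  by rewrite /flat_state -(@upd_flat _ 1 0 n) // -(@upd_flat _ 0 0 m).
have W2 : N.+1 <= W.
  apply: leq_trans (size_le_word_size x); apply: leq_trans sz.
  by rewrite /N !ltnS; lia.
have bits_b : bits b <= W + 3.
  apply: leq_trans (bitsD _ _) _; have := bits_sum_le x; rewrite -/W.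
  have -> : bits 2 = 2 by [].
  lia.
have leW : bits m + bits n <= W by rewrite /W /word_size !big_cons addnA leq_addr.
have W_gt0 : 0 < W by apply: leq_trans W2.
have E1 : N.+1 ^ D <= W ^ D by case: (D) => [|d] //; rewrite leq_exp2r.
have {leT} leT : T <= 4 * K * W ^ D.+1.
  apply: leq_trans leT _; rewrite -EK -ED expnSr [4 * K]mulnC -!mulnA leq_mul2l.
  apply/orP; right; rewrite [4 * _]mulnCA; apply: leq_mul => //.
  by clear -bits_b W_gt0; lia.
have EW : W <= W ^ D.+1 by rewrite expnS leq_pmulr // expn_gt0 W_gt0.
have -> : bits 0 = 1 by [].
have -> : bits 1 = 1 by [].
move: leT EW leW; rewrite mulnDl.
move: (W ^ D.+1) (4 * K * _) => E Z; lia.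
Qed.

End Final.

Theorem theorem2 (p1 p2 : nat) (hp1 : 0 < p1) (hp2 : 0 < p2) :
  tomography_in_poly_time (tnth [tuple vbar p1; vbar p2]).
Proof.
have [a [b runP]] := program_poly_time p1 p2.
exists (program p1 p2), a, b => I.
pose w := rproj I ord0 ++ rproj I ord_max ++ sproj I ord0 ++ sproj I ord_max.
have encE : encode_instance I = [:: nrows I, ncols I & w].
  by rewrite /encode_instance enum_ord2 /= !cats0 -!catA.
rewrite encE; have [|t ex_t le_t] := runP (nrows I) (ncols I) w.
  by rewrite /= !size_cat !size_tuple; lia.
set s := AState _ _ _ in ex_t.
exists t, (flat_state (arun (main p1 p2) s)).
have [] := @mainP p1 p2 I s erefl erefl erefl erefl => -[ok out].
  exists (Some (greedy_matrix p1 p2 I)); split; [exact: ex_t | exact: le_t | | exact: greedy_matrix_solution].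
  exact: etrans out (congr1 (cons 1) (esym (encode_greedy_matrix _ _ _))).
exists None; split; [exact: ex_t | exact: le_t | exact: out |].
case=> M /(solution_greedy_ok hp1 hp2).
exact: ok.
Qed.
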